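(* Let $n\ge1$, $d\ge 3$, $d\ge n$, let $\Sigma\subset\mathbb{R}^d$ be a root system of type $A_n$ with multiplicity $k>0$, and let $N^W$ be the $W$-invariant Dunkl Newton kernel. Then for $X,Y\in\overline{\mathfrak{a}^+}$ $$N^W(X,Y)\asymp\frac{|X-Y|^{2-d}}{\prod_{\alpha>0}|X-\sigma_\alpha Y|^{2k}},$$ with constants independent of $X$, $Y$ (both sides being $+\infty$ when $X=Y$).
   Context: Notation: $f\asymp g$ on a domain $D$ means there are constants $C_1,C_2>0$, independent of the point of $D$, with $C_1 g\le f\le C_2 g$ on $D$. Root system: $\Sigma\subset\mathbb{R}^d$ ($d\ge n$) is of type $A_n$: there is a linear isometry from $\{u\in\mathbb{R}^{n+1}:\sum u_i=0\}$ onto $\mathrm{span}(\Sigma)$ carrying $\{e_i-e_j: i\ne j,\ 1\le i,j\le n+1\}$ onto $\Sigma$ (so $|\alpha|^2=2$). The positive roots $\alpha>0$ (the set $\Sigma^+$) are the images of $e_i-e_j$, $i<j$. Write $\alpha(X)=\langle\alpha,X\rangle$, $\mathfrak{a}=\mathbb{R}^d$, $\mathfrak{a}^+=\{X:\alpha(X)>0\ \forall\alpha>0\}$, with closure $\overline{\mathfrak{a}^+}$. Let $\sigma_\alpha(X)=X-2\frac{\langle\alpha,X\rangle}{\langle\alpha,\alpha\rangle}\alpha$ and let $W$ be the (finite) group generated by the $\sigma_\alpha$. Dunkl operators with multiplicity $k>0$: $$T_\xi f(X)=\partial_\xi f(X)+\sum_{\alpha>0}k\,\alpha(\xi)\,\frac{f(X)-f(\sigma_\alpha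 X)}{\langle\alpha,X\rangle},\qquad \xi\in\mathbb{R}^d.$$ For fixed $Y\in\mathbb{R}^d$, the Dunkl kernel $E_k(\cdot,Y)$ is the unique real-analytic solution of $T_\xi|_X E_k(X,Y)=\langle\xi,Y\rangle E_k(X,Y)$ for all $\xi$, with $E_k(0,Y)=1$. The spherical function is $\psi_\lambda(X)=\frac1{|W|}\sum_{w\in W}E_k(wX,\lambda)$. The $W$-invariant Dunkl heat kernel is $$p_t^W(X,Y)=\frac{1}{2^{\gamma+d/2}c_k}\,t^{-d/2-\gamma}\,e^{-(|X|^2+|Y|^2)/(4t)}\,\psi_X\!\left(\frac{Y}{2t}\right),\qquad t>0,$$ where $\gamma=k|\Sigma^+|$ and $c_k=\int_{\mathbb{R}^d}e^{-|x|^2/2}\prod_{\alpha>0}|\langle\alpha,x\rangle|^{2k}\,dx>0$. The $W$-invariant Dunkl Newton kernel is $N^W(X,Y)=\int_0^\infty p_t^W(X,Y)\,dt\in(0,+\infty]$. *)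

(* Defs.v *)
From mathcomp Require Import all_boot all_order all_algebra finmap.
From mathcomp Require Import all_classical all_reals all_analysis.

Set Implicit Arguments.
Unset Strict Implicit.
Unset Printing Implicit Defensive.

Import Order.TTheory GRing.Theory Num.Theory.
Import numFieldNormedType.Exports.

Local Open Scope classical_set_scope.
Local Open Scope ring_scope.

Section Euclidean.
Context {R : realType} {d : nat}.
Implicit Types (x y a : 'rV[R]_d).

Definition dot x y : R := \sum_(i < d) x 0 i * y 0 i.

(* The library norm on ['rV[R]_d] is the sup norm, hence this one. *)
Definition enorm x : R := Num.sqrt (dot x x).

Definition reflection a x : 'rV[R]_d := x - (2 * dot a x / dot a a) *: a.

End Euclidean.

(* Lebesgue integral over [R^d] of a nonnegative function, as an iterated
   integral (Tonelli); [row_mx t%:M v] is the vector (t, v_1, ..., v_d). *)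
Fixpoint integral_Rn {R : realType} {d : nat} :
    ('rV[R]_d -> \bar R) -> \bar R :=
  match d return ('rV[R]_d -> \bar R) -> \bar R with
  | 0 => fun f => f 0
  | d'.+1 => fun f => (\int[lebesgue_measure]_(t in [set: R])
      integral_Rn (fun v : 'rV[R]_d' => f (row_mx (t%:M : 'rV[R]_1) v)))%E
  end.

(* At every point, [f] is locally the sum of an absolutely convergent power
   series in [d] variables.  The sum over all multi-indices is taken along the
   cubes {0, ..., N-1}^d. *)
Definition real_analytic {R : realType} {d : nat} (f : 'rV[R]_d -> R) : Prop :=
  forall x : 'rV[R]_d, exists (c : ('I_d -> nat) -> R) (r : R), 0 < r /\
    forall h : 'rV[R]_d, enorm h < r ->
      let term N (m : {ffun 'I_d -> 'I_N}) : R :=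
        c (fun i => m i : nat) * \prod_(i < d) h 0 i ^+ m i in
      cvgn (fun N : nat => \sum_(m : {ffun 'I_d -> 'I_N}) `|term N m|) /\
      (\sum_(m : {ffun 'I_d -> 'I_N}) term N m) @[N --> \oo] --> f (x + h).

(* [phi] is defined on the whole of [R^(n+1)], but only its restriction to the
   hyperplane of vectors with zero coordinate sum is constrained. *)
Definition root_system_A {R : realType} (n d : nat)
    (Sigma Pos : {fset 'rV[R]_d}) : Prop :=
  let H := [set u : 'rV[R]_n.+1 | \sum_i u 0 i = 0] in
  let e (i : 'I_n.+1) : 'rV[R]_n.+1 := delta_mx 0 i in
  exists phi : {linear 'rV[R]_n.+1 -> 'rV[R]_d},
    [/\ forall u, H u -> enorm (phi u) = enorm u,
        phi @` H = [set v | v \in <<(Sigma : seq 'rV[R]_d)>>%VS],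
        forall a, a \in Sigma <->
          exists i j : 'I_n.+1, i != j /\ a = phi (e i - e j) &
        forall a, a \in Pos <->
          exists i j : 'I_n.+1, (i < j)%N /\ a = phi (e i - e j)].

Section Dunkl.
Context {R : realType} {d : nat}.
Variables (Sigma Pos : {fset 'rV[R]_d}) (k : R).
Implicit Types (X Y xi lambda : 'rV[R]_d) (E : 'rV[R]_d -> 'rV[R]_d -> R).

Definition chamber : set 'rV[R]_d :=
  [set X | forall a, a \in Pos -> 0 < dot a X].

Definition transformation_group (G : set ('rV[R]_d -> 'rV[R]_d)) : Prop :=
  [/\ G id, (forall f g, G f -> G g -> G (f \o g)) &
      (forall f g, G f -> cancel f g -> cancel g f -> G g)].

Definition weyl_group : set ('rV[R]_d -> 'rV[R]_d) :=
  smallest transformation_group [set reflection a | a in [set` Sigma]].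

(* (f(X) - f(sigma_a X)) / <a, X>, extended to the hyperplane <a, X> = 0 by its
   limit there for a C^1 function [f]. *)
Definition difference_quotient (f : 'rV[R]_d -> R) (a X : 'rV[R]_d) : R :=
  if dot a X == 0 then 2 / dot a a * 'D_a f X
  else (f X - f (reflection a X)) / dot a X.

Definition dunkl_operator xi (f : 'rV[R]_d -> R) X : R :=
  'D_xi f X + \sum_(a <- Pos) k * dot a xi * difference_quotient f a X.

Definition is_dunkl_kernel E : Prop := forall Y,
  [/\ real_analytic (E ^~ Y),
      forall xi X, dunkl_operator xi (E ^~ Y) X = dot xi Y * E X Y &
      E 0 Y = 1].

Definition spherical E lambda X : R :=
  (#|` fset_set weyl_group|)%:R^-1 * \sum_(w \in weyl_group) E (w X) lambda.

Definition dunkl_gamma : R := k * #|` Pos|%:R.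

Definition dunkl_weight X : R := \prod_(a <- Pos) `|dot a X| `^ (2 * k).

Definition dunkl_c : R :=
  fine (integral_Rn
    (fun x : 'rV[R]_d => (expR (- enorm x ^+ 2 / 2) * dunkl_weight x)%:E)).

Definition heat_kernel E (t : R) X Y : R :=
  (2 `^ (dunkl_gamma + d%:R / 2) * dunkl_c)^-1 *
  t `^ (- (d%:R / 2) - dunkl_gamma) *
  expR (- (enorm X ^+ 2 + enorm Y ^+ 2) / (4 * t)) *
  spherical E X ((2 * t)^-1 *: Y).

Definition newton_kernel E X Y : \bar R :=
  (\int[lebesgue_measure]_(t in [set` `]0%R, +oo[%R]) (heat_kernel E t X Y)%:E)%E.

(* The value on the diagonal is the one given by the convention 1 / 0 = +oo;
   for X, Y in the closed chamber the denominator vanishes only there. *)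
Definition newton_bound X Y : \bar R :=
  if X == Y then +oo%E
  else (enorm (X - Y) `^ (2 - d%:R) /
        \prod_(a <- Pos) enorm (X - reflection a Y) `^ (2 * k))%:E.

End Dunkl.

Definition comparable_on {R : realType} {T : Type} (D : set T)
    (f g : T -> \bar R) : Prop :=
  exists C1 C2 : R, [/\ 0 < C1, 0 < C2 &
    forall x, D x -> (C1%:E * g x <= f x <= C2%:E * g x)%E].

(* Main.v *)
(* For a permutation [p] of the coordinates and [X], [Y] in the closed chamber put
   [G_p(s) = exp(- s <X,Y>) E(s (p X), Y)].  Applying the Dunkl operator in the radial
   direction gives the linear system
     [s G_p' = - s c_p G_p + k * sum_(i < j) (G_(p with i, j exchanged) - G_p)],
   with [G_p(0) = 1] and [c_p = <X,Y> - <p X,Y> >= 0].  Its off-diagonal coefficients are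
   nonnegative, so it obeys a comparison principle, and [G_1(1)] is squeezed between
   explicit super- and subsolutions, both comparable to
   [prod_(i < j) (1 + (x_i - x_j) (y_i - y_j))^(-k)] at [p = 1], [s = 1]:
   - the supersolution is [(1 + th s c_p)^-1 prod_(i < j) (1 + th s p_ij)^(-k)], with [th]
     small and [p_ij = (x_i - x_j) (y_i - y_j)];
   - the subsolution is [exp(- s^M c~_p)] times a product, where [c~] is computed from the
     sequences whose gaps are the [M]-th powers of the gaps of [x] and [y].  For large
     [M] the factor [M] coming from [d/ds s^M] absorbs all losses, and the part of
     [s c_p] not dominated by [s^M c~_p] is integrable for [ds / s].
   Both verifications compare [sum_(i < j) f((x_(p i) - x_(p j)) (y_i - y_j))] with its
   value at [p = 1].  Sorting [p] by exchanges, each exchange changes the sum by second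
   differences of [f] over products of intervals, which are bounded by the decrease of
   [c_p]; this is where type A is used.
   The resulting bounds for the heat kernel,
   [t^(-d/2) exp(- |X-Y|^2 / (4 t)) prod (t + <a,X> <a,Y> / 2)^(-k)], are integrated in
   [t], with [|X - s_a Y|^2 = |X - Y|^2 + 2 <a,X> <a,Y>]. *)
Require Import Defs.
From mathcomp Require Import all_boot all_order all_algebra finmap all_fingroup.
From mathcomp Require Import all_classical all_reals all_analysis.
From mathcomp Require Import measurable_realfun ring lra.

Set Implicit Arguments.
Unset Strict Implicit.
Unset Printing Implicit Defensive.

Import Order.TTheory GRing.Theory Num.Theory.
Import numFieldNormedType.Exports.

Local Open Scope classical_set_scope.
Local Open Scope ring_scope.

(** * Comparison principle *)

Section RealDerivatives.
Context {R : realType}.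
Implicit Types (f g : R -> R) (t a b : R).

Lemma is_derive_addf f g t a b : is_derive t 1 f a -> is_derive t 1 g b ->
  is_derive t 1 (fun s => f s + g s) (a + b).
Proof. exact: is_deriveD. Qed.

Lemma is_derive_oppf f t a : is_derive t 1 f a ->
  is_derive t 1 (fun s => - f s) (- a).
Proof. exact: is_deriveN. Qed.

Lemma is_derive_mulf f g t a b : is_derive t 1 f a -> is_derive t 1 g b ->
  is_derive t 1 (fun s => f s * g s) (a * g t + f t * b).
Proof.
move=> fa gb; have H := is_deriveM fa gb.
by apply: (is_derive_eq H); rewrite -![_ *: _]/(_ * _); ring.
Qed.

Lemma is_derive_scalef f t a b : is_derive t 1 f a ->
  is_derive t 1 (fun s => b * f s) (b * a).
Proof. exact: is_deriveZ. Qed.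

Lemma is_derive_sumf (I : Type) (r : seq I) (F : I -> R -> R) (dF : I -> R) t :
  (forall i, is_derive t 1 (F i) (dF i)) ->
  is_derive t 1 (fun s => \sum_(i <- r) F i s) (\sum_(i <- r) dF i).
Proof.
move=> FP; elim: r => [|i r IH].
  rewrite big_nil (_ : (fun s => _) = cst 0); first exact: is_derive_cst.
  by apply/funext => s; rewrite big_nil.
rewrite big_cons (_ : (fun s => _) = (fun s => F i s + \sum_(j <- r) F j s)).
  exact: is_derive_addf.
by apply/funext => s; rewrite big_cons.
Qed.

Lemma is_derive_expRf f t a : is_derive t 1 f a ->
  is_derive t 1 (fun s => expR (f s)) (a * expR (f t)).
Proof.
by move=> fa; rewrite mulrC; apply: (@is_derive1_comp R expR f).
Qed.

Lemma is_derive_lnf f t a : 0 < f t -> is_derive t 1 f a ->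
  is_derive t 1 (fun s => ln (f s)) (a / f t).
Proof.
move=> ft fa; rewrite mulrC; apply: (@is_derive1_comp R (@ln R) f).
exact: is_derive1_ln.
Qed.

Lemma is_derive_continuous f t a : is_derive t 1 f a -> {for t, continuous f}.
Proof.
by move=> [df _]; apply: differentiable_continuous; exact/derivable1_diffP.
Qed.

Lemma is_derive_ndecr f (df : R -> R) a b : a <= b ->
  (forall t, is_derive t 1 f (df t)) -> (forall t, 0 <= df t) -> f a <= f b.
Proof.
move=> ab fd df0.
have [|c _ E] := @MVT_segment R f df a b ab (fun t _ => fd t).
  by apply: continuous_subspaceT => u; exact: is_derive_continuous (fd u).
by rewrite -subr_ge0 E mulr_ge0 ?subr_ge0.
Qed.

End RealDerivatives.

(** Left difference quotients at [t] are nonpositive, hence so is their limit. The minimum is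
    one-sided because [t] may be the right end of the time interval. *)
Lemma left_min_derive_le0 (R : realType) (f : R -> R) (t D : R) :
  0 < t -> is_derive t 1 f D ->
  (forall s, 0 <= s <= t -> f t <= f s) -> D <= 0.
Proof.
move=> t0 df fmin; rewrite leNgt; apply/negP => D0.
have [dr dE] := df.
have addNr_ge0 (a b : R) : (0 <= - a + b) = (a <= b) by rewrite addrC subr_ge0.
have : (h^-1 *: ((f \o shift t) (h *: (1:R)) - f t)) @[h --> 0^'] --> D.
  by rewrite -dE.
move/cvgrPdist_lt => /(_ D D0) /nbhs_ballP[e /= e0 He].
(* The bound [e / 2] keeps the increment in the ball, and the bound [t] keeps [h + t]
   nonnegative. *)
pose h := - Num.min (e / 2) t.
have hlt : h < 0 by rewrite /h oppr_lt0 lt_min t0 andbT divr_gt0.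
have hball : ball 0 e h.
  rewrite /ball /= sub0r normrN ltr0_norm// opprK gt_min.
  by rewrite ltr_pdivrMr// ltr_pMr// ltr1n.
have := He h hball (ltr0_neq0 hlt).
rewrite /= [_ *: 1]mulr1 => Hlt.
have fh : f t <= f (h + t).
  apply: fmin; apply/andP; split; last by rewrite gerDr ltW.
  by rewrite /h addrC subr_ge0 ge_min lexx orbT.
have : h^-1 * (f (h + t) - f t) <= 0.
  by apply: mulr_le0_ge0; rewrite ?invr_le0 ?subr_ge0// ltW.
move=> Hle; move: Hlt; rewrite ltNge => /negP; apply.
by apply: le_trans (ler_norm _); rewrite -[_ *: _]/(_ * _); lra.
Qed.

(* At a negative minimum over all components the jump terms and the killing term
   both push upwards; the term [e * s] makes this strict. *)
Lemma cooperative_system_ge0 (R : realType) (I J : finType) (m : J -> I -> I)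
    (r : R) (D dD c : I -> R -> R) (T : R) :
  0 <= r -> 0 <= T ->
  (forall i s, 0 < s <= T -> 0 <= c i s) ->
  (forall i, {within `[0, T], continuous (D i)}) ->
  (forall i, 0 <= D i 0) ->
  (forall i s, 0 < s <= T -> is_derive s 1 (D i) (dD i s)) ->
  (forall i s, 0 < s <= T ->
    - c i s * D i s + r * \sum_j (D (m j i) s - D i s) <= s * dD i s) ->
  forall i, 0 <= D i T.
Proof.
move=> r0 T0 c0 cD D0 dDP sys i.
suff H e : 0 < e -> 0 <= D i T + e * T.
  have [T00|Tpos] := eqVneq T 0; first by rewrite T00.
  have {}Tpos : 0 < T by rewrite lt_neqAle eq_sym Tpos.
  rewrite leNgt; apply/negP => DT.
  have := H (- D i T / T / 2); rewrite !divr_gt0 ?oppr_gt0// => /(_ isT).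
  rewrite mulrAC divfK ?gt_eqF//; lra.
move=> e0; pose F j s := D j s + e * s.
have cF j : {within `[0, T], continuous (F j)}.
  move=> x; apply: cvgD; first exact: cD.
  by apply: cvgMr; apply: continuous_subspaceT => y; exact: cvg_id.
(* [mn j] is a minimum point of [F j] on [[0, T]]; [j0] below is the component with the smallest
   minimum, so [F j0 (mn j0)] bounds all components at all times. *)
pose mn j := xget 0 [set t | t \in `[0, T]%R /\ forall s, s \in `[0, T]%R -> F j t <= F j s].
have mnP j : mn j \in `[0, T]%R /\ forall s, s \in `[0, T]%R -> F j (mn j) <= F j s.
  rewrite /mn; case: xgetP => [y _ //|nex]; exfalso.
  have [t tI tmin] := EVT_min T0 (cF j).
  by have := nex t; apply.
pose j0 := [arg min_(j < i) F j (mn j)]%O.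
have j0min j s : 0 <= s <= T -> F j0 (mn j0) <= F j s.
  move=> sT; rewrite /j0; case: arg_minP => // j1 _ /(_ j isT) j1min.
  by apply: le_trans j1min _; apply: (mnP j).2; rewrite in_itv.
suff Fge0 : 0 <= F j0 (mn j0).
  by apply: le_trans Fge0 _; apply: j0min; rewrite T0 lexx.
set t0 := mn j0; have := (mnP j0).1; rewrite in_itv/= -/t0 => /andP[t00 t0T].
rewrite leNgt; apply/negP => Fneg.
have t0pos : 0 < t0.
  rewrite lt_neqAle t00 andbT; apply/negP => /eqP t0E.
  move: Fneg; rewrite /F -t0E mulr0 addr0 ltNge => /negP; apply; exact: D0.
have t0I : 0 < t0 <= T by rewrite t0pos.
have Dneg : D j0 t0 < 0.
  by apply: le_lt_trans Fneg; rewrite /F lerDl mulr_ge0// ltW.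
have dD0 : 0 <= t0 * dD j0 t0.
  apply: le_trans (sys j0 t0 t0I); apply: addr_ge0.
    by rewrite mulNr oppr_ge0 mulr_ge0_le0 ?c0// ltW.
  apply: mulr_ge0 => //; apply: sumr_ge0 => j _; rewrite subr_ge0.
  by have := j0min (m j j0) t0; rewrite t00 t0T => /(_ isT); rewrite /F lerD2r.
have {}dD0 : 0 <= dD j0 t0 by rewrite -(pmulr_rge0 _ t0pos).
have dF : is_derive t0 1 (F j0) (dD j0 t0 + e).
  have := dDP j0 t0 t0I => ?.
  have -> : F j0 = D j0 + (e *: (id : R -> R)) by apply/funext.
  rewrite -[e in X in is_derive _ _ _ X]mulr1.
  by apply: is_deriveD; apply: is_deriveZ.
have := left_min_derive_le0 t0pos dF.
suff Hs : forall s, 0 <= s <= t0 -> F j0 t0 <= F j0 s by move=> /(_ Hs); lra.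
by move=> s /andP[s0 st]; apply: j0min; rewrite s0 (le_trans st).
Qed.

(** * Sorting a permutation *)

Definition moved n (p : 'S_n) : nat := #|[set l | p l != l]%SET|.

(* Selection sort: exchange the first wrongly placed value with the right one. *)
Lemma perm_sort_ind n (P : 'S_n -> Prop) :
  P 1%g ->
  (forall (p : 'S_n) (i j : 'I_n), (i < j)%N -> (p j < p i)%N ->
    (moved (tperm i j * p)%g < moved p)%N -> P (tperm i j * p)%g -> P p) ->
  forall p, P p.
Proof.
move=> P1 PS p; move: {2}(moved p).+1 (ltnSn (moved p)) => k.
elim: k p => // k IH p; rewrite ltnS => pk.
have [p1|pN1] := pickP (fun l => p l != l); last first.
  by rewrite (_ : p = 1%g)//; apply/permP => l; rewrite perm1; apply/eqP/negbFE/pN1.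
move=> p1N.
case: (@arg_minnP _ p1 (fun l => p l != l) (fun l : 'I_n => nat_of_ord l) p1N).
move=> i piN imin.
have fixed (l : 'I_n) : (l < i)%N -> p l = l.
  move=> li; apply/eqP; apply: contraLR li => /imin; by rewrite -leqNgt.
(* [j] is the position of the value [i]. Everything before the first moved position [i] is fixed, so
   both [j] and the value [p i] exceed [i]. *)
pose j := (p^-1)%g i.
have pj : p j = i by rewrite /j permKV.
have ij : (i < j)%N.
  rewrite ltnNge leq_eqVlt; apply/negP => /orP[/eqP/val_inj ji|/fixed].
    by move: piN; rewrite -{1}ji pj eqxx.
  by rewrite pj => ij; move: piN; rewrite {1}ij pj eqxx.
have pji : (p j < p i)%N.
  rewrite pj ltnNge leq_eqVlt; apply/negP => /orP[/eqP/val_inj pii|/fixed].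
    by move: piN; rewrite pii eqxx.
  by move/perm_inj => pii; move: piN; rewrite pii eqxx.
have mlt : (moved (tperm i j * p)%g < moved p)%N.
  apply: proper_card; apply/properP; split; last first.
    by exists i; rewrite !inE// permM tpermL pj eqxx.
  apply/fintype.subsetP => l; rewrite !inE permM.
  case: tpermP => [->|->|//]; first by rewrite pj eqxx.
  by move=> _; rewrite pj -val_eqE/= ltn_eqF.
by apply: (PS p i j) => //; apply: IH; apply: leq_trans mlt _.
Qed.

Section Rearrangement.
Context {R : realType} {n : nat}.
Implicit Types (x y : 'I_n -> R) (p : 'S_n) (i j : 'I_n).

Definition nonincr x := forall i j, (i <= j)%N -> x j <= x i.

(** The defect in the rearrangement inequality, called [c_p] in the overview. *)
Definition cost x y p : R := \sum_i (x i - x (p i)) * y i.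

(** By [cost_tperm], the change of the cost when positions [i] and [j] are exchanged. At the
    identity it is [p_ij]. *)
Definition swap_cost x y p i j : R := (y i - y j) * (x (p i) - x (p j)).

Lemma swap_costC x y p i j : swap_cost x y p i j = swap_cost x y p j i.
Proof. by rewrite /swap_cost; ring. Qed.

Lemma cost1 x y : cost x y 1%g = 0.
Proof. by rewrite /cost big1// => i _; rewrite perm1 subrr mul0r. Qed.

Lemma cost_tperm x y p i j :
  cost x y (tperm i j * p)%g = cost x y p + swap_cost x y p i j.
Proof.
have [<-|ij] := eqVneq i j.
  by rewrite tperm1 mul1g /swap_cost subrr mul0r addr0.
rewrite /cost (bigD1 i)//= (bigD1 j) ?(eq_sym j)//=.
rewrite [in RHS](bigD1 i)//= [in RHS](bigD1 j) ?(eq_sym j)//=.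
rewrite !permM tpermL tpermR.
rewrite [X in _ + (_ + X) = _](eq_bigr (fun l => (x l - x (p l)) * y l)); last first.
  by move=> l /andP[li lj]; rewrite permM tpermD// eq_sym.
by rewrite /swap_cost; ring.
Qed.

Lemma swap_cost1_ge0 x y i j : nonincr x -> nonincr y ->
  0 <= swap_cost x y 1%g i j.
Proof.
wlog ij : i j / (i <= j)%N => [H xd yd|xd yd].
  have /orP[ij|ji] := leq_total i j; first exact: H.
  by rewrite swap_costC; exact: H.
by rewrite /swap_cost !perm1 mulr_ge0// subr_ge0; [exact: yd|exact: xd].
Qed.

Lemma swap_cost_inverted x y p i j : nonincr x -> nonincr y ->
  (i < j)%N -> (p j < p i)%N -> swap_cost x y p i j <= 0.
Proof.
move=> xd yd ij pji; apply: mulr_ge0_le0; first by rewrite subr_ge0 yd// ltnW.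
by rewrite subr_le0 xd// ltnW.
Qed.

(** Rearrangement inequality: each sorting exchange lowers the cost, which ends at 0. *)
Lemma cost_ge0 x y p : nonincr x -> nonincr y -> 0 <= cost x y p.
Proof.
move=> xd yd; elim/perm_sort_ind: p => [|p i j ij pji _]; first by rewrite cost1.
by rewrite cost_tperm; have := swap_cost_inverted xd yd ij pji; lra.
Qed.

(** The permutation after the exchange has nonnegative cost. This keeps the denominators [1 + c + z]
    at least 1. *)
Lemma swap_cost_ge x y p i j : nonincr x -> nonincr y ->
  - cost x y p <= swap_cost x y p i j.
Proof.
by move=> xd yd; have := cost_ge0 (tperm i j * p)%g xd yd; rewrite cost_tperm; lra.
Qed.

Lemma sum_ord2_pair (g : 'I_n -> 'I_n -> R) i j : i != j ->
  (forall l m, g l m = g m l) ->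
  \sum_l \sum_m g l m = g i i + g j j + g i j *+ 2 +
    (\sum_(l | (l != i) && (l != j)) (g i l + g j l)) *+ 2 +
    \sum_(l | (l != i) && (l != j)) \sum_(m | (m != i) && (m != j)) g l m.
Proof.
move=> ij gC.
have D (F : 'I_n -> R) : \sum_l F l =
    F i + F j + \sum_(l | (l != i) && (l != j)) F l.
  by rewrite (bigD1 i)//= (bigD1 j) ?(eq_sym j)//= addrA.
rewrite D !(D (g _)).
rewrite [X in _ + X = _](eq_bigr (fun l => (g i l + g j l) +
    \sum_(m | (m != i) && (m != j)) g l m)); last first.
  by move=> l _; rewrite (D (g l)) (gC l i) (gC l j).
by rewrite !big_split/= (gC j i); ring.
Qed.

(** Only entries with an index [i] or [j] change. [K] is the allowance for each of the at most [n]
    other indices and for the pair [(i, j)] itself; symmetry doubles the total. *)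
Lemma swap_sum_le (g g' : 'I_n -> 'I_n -> R) i j K : i != j -> 0 <= K ->
  (forall l m, g l m = g m l) -> (forall l m, g' l m = g' m l) ->
  (forall l, g' l l = g l l) ->
  (forall l m, l != i -> l != j -> m != i -> m != j -> g' l m = g l m) ->
  (forall l, l != i -> l != j -> g' i l + g' j l <= g i l + g j l + K) ->
  g' i j <= g i j + K ->
  \sum_l \sum_m g' l m <= \sum_l \sum_m g l m + (n%:R + 1) * K *+ 2.
Proof.
move=> ij K0 gC gC' gd goff grow gij.
rewrite (sum_ord2_pair ij gC) (sum_ord2_pair ij gC') !gd.
have -> : \sum_(l | (l != i) && (l != j)) \sum_(m | (m != i) && (m != j)) g' l m =
    \sum_(l | (l != i) && (l != j)) \sum_(m | (m != i) && (m != j)) g l m.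
  by apply: eq_bigr => l /andP[? ?]; apply: eq_bigr => m /andP[? ?]; rewrite goff.
have : \sum_(l | (l != i) && (l != j)) (g' i l + g' j l) <=
    \sum_(l | (l != i) && (l != j)) (g i l + g j l) + n%:R * K.
  apply: (@le_trans _ _ (\sum_(l | (l != i) && (l != j)) (g i l + g j l + K))).
    by apply: ler_sum => l /andP[? ?]; exact: grow.
  rewrite big_split/= lerD2l sumr_const -[leLHS]mulr_natl ler_wpM2r// ler_nat.
  by rewrite (leq_trans (max_card _))// card_ord.
rewrite !mulr2n; lra.
Qed.

Lemma swap_cost_tpermL x y p i j l : l != i -> l != j ->
  swap_cost x y (tperm i j * p)%g i l = (y i - y l) * (x (p j) - x (p l)).
Proof. by move=> li lj; rewrite /swap_cost !permM tpermL tpermD// eq_sym. Qed.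

Lemma swap_cost_tpermR x y p i j l : l != i -> l != j ->
  swap_cost x y (tperm i j * p)%g j l = (y j - y l) * (x (p i) - x (p l)).
Proof. by move=> li lj; rewrite /swap_cost !permM tpermR tpermD// eq_sym. Qed.

Lemma swap_cost_tperm_pair x y p i j :
  swap_cost x y (tperm i j * p)%g i j = - swap_cost x y p i j.
Proof. by rewrite /swap_cost !permM tpermL tpermR; ring. Qed.

Lemma swap_cost_tpermD x y p i j l m :
  l != i -> l != j -> m != i -> m != j ->
  swap_cost x y (tperm i j * p)%g l m = swap_cost x y p l m.
Proof. by move=> ? ? ? ?; rewrite /swap_cost !permM !tpermD// eq_sym. Qed.

End Rearrangement.

(* With [A i j := b + X_i * L_j], the second difference of [z / (b + z)] over the
   rectangle is [b * (X2 - X1) * (L2 - L1) * (b ^+ 2 - X1 * X2 * L1 * L2)] divided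
   by the product of the four [A i j]. *)
Lemma rational_second_difference (R : realFieldType) (b X1 X2 L1 L2 : R)
    (f := fun z => z / (b + z)) :
  1 <= b <= 2 -> X1 <= X2 -> L1 <= L2 ->
  1 <= b + X1 * L1 -> 1 <= b + X1 * L2 -> 1 <= b + X2 * L1 -> 1 <= b + X2 * L2 ->
  f (X2 * L2) + f (X1 * L1) <= f (X2 * L1) + f (X1 * L2) +
    8 * ((X2 - X1) * (L2 - L1)).
Proof.
move=> /andP[b1 b2] X12 L12 h11 h12 h21 h22.
set A := b + X1 * L1; set B := b + X2 * L2.
set C := b + X2 * L1; set D := b + X1 * L2.
have -> : f (X2 * L2) + f (X1 * L1) = f (X2 * L1) + f (X1 * L2) +
    ((X2 - X1) * (L2 - L1)) * (b * (b * (A^-1 + B^-1) - 1) / (C * D)).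
  rewrite /f -/A -/B -/C -/D; apply/eqP; rewrite -subr_eq0; apply/eqP.
  have dA : X1 * L1 = A - b by rewrite /A; ring.
  rewrite /A /B /C /D; field; do 4?[apply/andP; split];
    apply: lt0r_neq0; lra.
rewrite lerD2l mulrC ler_wpM2r ?mulr_ge0 ?subr_ge0//.
have C1 : C^-1 <= 1 by rewrite invf_le1// (lt_le_trans ltr01).
have D1 : D^-1 <= 1 by rewrite invf_le1// (lt_le_trans ltr01).
have A1 : A^-1 <= 1 by rewrite invf_le1// (lt_le_trans ltr01).
have B1 : B^-1 <= 1 by rewrite invf_le1// (lt_le_trans ltr01).
have C0 : 0 <= C^-1 by rewrite invr_ge0 (le_trans ler01).
have D0 : 0 <= D^-1 by rewrite invr_ge0 (le_trans ler01).
have A0 : 0 <= A^-1 by rewrite invr_ge0 (le_trans ler01).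
have B0 : 0 <= B^-1 by rewrite invr_ge0 (le_trans ler01).
have CD0 : 0 <= (C * D)^-1 by rewrite invfM mulr_ge0.
have CD1 : (C * D)^-1 <= 1 by rewrite invfM mulr_ile1.
apply: (@le_trans _ _ (b * (b * (A^-1 + B^-1)) / (C * D))).
  by rewrite ler_wpM2r// ler_wpM2l; lra.
(* Each of the three factors is at most 2. *)
have H : b * (b * (A^-1 + B^-1)) <= 8.
  have -> : (8 : R) = 2 * (2 * 2) by ring.
  by apply: ler_pM => //; [lra|apply: mulr_ge0; lra|apply: ler_pM => //; lra].
apply: (@le_trans _ _ (8 * 1)); last by rewrite mulr1.
by apply: ler_pM => //; rewrite !mulr_ge0//; lra.
Qed.

(** The mixed derivative of [exp(- X L)] is [(X L - 1) exp(- X L) <= 1]. This bound is integrated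
    over the rectangle by two monotonicity arguments, first in [L], then in [X]. *)
Lemma expR_second_difference (R : realType) (X1 X2 L1 L2 : R) :
  X1 <= X2 -> L1 <= L2 ->
  expR (- (X2 * L2)) + expR (- (X1 * L1)) <=
  expR (- (X2 * L1)) + expR (- (X1 * L2)) + (X2 - X1) * (L2 - L1).
Proof.
move=> X12 L12.
have bnd (z : R) : (z - 1) * expR (- z) <= 1.
  rewrite expRN ler_pdivrMr ?expR_gt0// mul1r.
  by have := expR_ge1Dx z; lra.
have dexp (a t : R) : is_derive t 1 (fun t : R => expR (- (a * t))) (- a * expR (- (a * t))).
  apply: is_derive_expRf; apply: is_derive_oppf.
  by rewrite -[X in is_derive _ _ _ X]mulr1; apply: is_derive_scalef; exact: is_derive_id.
have mono (X : R) : 0 <= L2 * expR (- (X * L2)) - L1 * expR (- (X * L1)) + (L2 - L1).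
  have := @is_derive_ndecr R (fun L : R => L * expR (- (X * L)) + L)
    (fun L : R => (1 - X * L) * expR (- (X * L)) + 1) _ _ L12.
  have dF (L : R) : is_derive L 1 (fun L : R => L * expR (- (X * L)) + L)
      ((1 - X * L) * expR (- (X * L)) + 1).
    have H := is_derive_addf (is_derive_mulf (is_derive_id L 1) (dexp X L)) (is_derive_id L 1).
    by apply: (is_derive_eq H); ring.
  move=> /(_ dF); rewrite -subr_ge0 => H.
  suff : 0 <= L2 * expR (- (X * L2)) + L2 - (L1 * expR (- (X * L1)) + L1) by lra.
  by apply: H => t; have := bnd (X * t); lra.
have := @is_derive_ndecr R (fun X : R => expR (- (L1 * X)) - expR (- (L2 * X)) + (L2 - L1) * X)
    (fun X : R => L2 * expR (- (X * L2)) - L1 * expR (- (X * L1)) + (L2 - L1)) _ _ X12.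
have dF (X : R) : is_derive X 1 (fun X : R => expR (- (L1 * X)) - expR (- (L2 * X)) + (L2 - L1) * X)
    (L2 * expR (- (X * L2)) - L1 * expR (- (X * L1)) + (L2 - L1)).
  have H := is_derive_addf (is_derive_addf (dexp L1 X) (is_derive_oppf (dexp L2 X)))
    (is_derive_scalef (L2 - L1) (is_derive_id X 1)).
  by apply: (is_derive_eq H); rewrite (mulrC X) (mulrC X); ring.
by move=> /(_ dF mono); rewrite ![_ * X1]mulrC ![_ * X2]mulrC; lra.
Qed.

(** * Effect of sorting on sums over pairs *)

Section SortingBounds.
Context {R : realType} {n : nat}.
Implicit Types (x y : 'I_n -> R) (p : 'S_n) (i j : 'I_n).

(** Each exchange changes the sum by at most a multiple of the drop in cost, by
    [rational_second_difference]. The condition [cost x y p <= c] persists under sorting and keeps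
    all denominators at least 1. *)
Lemma rational_sorting_bound x y (c : R) p (f := fun z => z / (1 + c + z)) :
  nonincr x -> nonincr y -> 0 <= c <= 1 -> cost x y p <= c ->
  \sum_i \sum_j f (swap_cost x y 1%g i j) <=
  \sum_i \sum_j f (swap_cost x y p i j) + 16 * (n%:R + 1) * cost x y p.
Proof.
move=> xd yd /andP[c0 c1].
elim/perm_sort_ind: p => [|p i j ij pji _ IH] pc; first by rewrite cost1 mulr0 addr0.
have costE := cost_tperm x y p i j.
have t0 := swap_cost_inverted xd yd ij pji.
have pc' : cost x y (tperm i j * p)%g <= c by lra.
have geb q l m : cost x y q <= c -> 1 <= 1 + c + swap_cost x y q l m.
  by have := swap_cost_ge q l m xd yd; lra.
have ijN : i != j by rewrite -val_eqE/= ltn_eqF.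
suff : \sum_l \sum_m f (swap_cost x y (tperm i j * p)%g l m) <=
    \sum_l \sum_m f (swap_cost x y p l m) +
    (n%:R + 1) * (8 * - swap_cost x y p i j) *+ 2.
  by move: (IH pc'); rewrite costE mulr2n; lra.
apply: (swap_sum_le ijN).
- by lra.
- by move=> l m; rewrite swap_costC.
- by move=> l m; rewrite swap_costC.
- by move=> l; rewrite /swap_cost !subrr !mul0r.
- by move=> l m ? ? ? ?; rewrite swap_cost_tpermD.
- move=> l li lj; rewrite swap_cost_tpermL// swap_cost_tpermR//.
  (* The drop in cost is the area of a rectangle whose corner products are, for each [l], the swap
     costs with [l] before and after the exchange. *)
  have -> : - swap_cost x y p i j =
      ((y i - y l) - (y j - y l)) * ((x (p j) - x (p l)) - (x (p i) - x (p l))).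
    by rewrite /swap_cost; ring.
  apply: rational_second_difference.
  + by apply/andP; split; lra.
  + by have := yd i j (ltnW ij); lra.
  + by have := xd (p j) (p i) (ltnW pji); lra.
  + by have := geb _ j l pc'; rewrite swap_cost_tpermR.
  + by have := geb _ j l pc.
  + by have := geb _ i l pc.
  + by have := geb _ i l pc'; rewrite swap_cost_tpermL.
(* The entry of the pair itself changes sign: here [t <= 0], [f (- t) <= - t] and [t <= f t]. *)
- rewrite swap_cost_tperm_pair.
  have h1 := geb _ i j pc.
  move: t0 h1; set t := swap_cost x y p i j => t0 h1.
  rewrite /f mulNr.
  have a0 : 0 <= (1 + c - t)^-1 by rewrite invr_ge0; lra.
  have a1 : (1 + c - t)^-1 <= 1 by rewrite invf_le1; lra.
  have b0 : 0 <= (1 + c + t)^-1 by rewrite invr_ge0; lra.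
  have b1 : (1 + c + t)^-1 <= 1 by rewrite invf_le1; lra.
  by nra.
Qed.

(** The same induction with the inequality in the other direction; [expR_second_difference] holds on
    all rectangles, so the cost may be large. *)
Lemma expR_sorting_bound x y p (f := fun z => 1 - expR (- z)) :
  nonincr x -> nonincr y ->
  \sum_i \sum_j f (swap_cost x y p i j) <=
  \sum_i \sum_j f (swap_cost x y 1%g i j) + 2 * (n%:R + 1) * cost x y p.
Proof.
move=> xd yd.
elim/perm_sort_ind: p => [|p i j ij pji _ IH]; first by rewrite cost1 mulr0 addr0.
have costE := cost_tperm x y p i j.
have t0 := swap_cost_inverted xd yd ij pji.
have ijN : i != j by rewrite -val_eqE/= ltn_eqF.
suff : \sum_l \sum_m f (swap_cost x y p l m) <=
    \sum_l \sum_m f (swap_cost x y (tperm i j * p)%g l m) +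
    (n%:R + 1) * (- swap_cost x y p i j) *+ 2.
  by move: IH; rewrite costE mulr2n; lra.
apply: (swap_sum_le ijN).
- by lra.
- by move=> l m; rewrite swap_costC.
- by move=> l m; rewrite swap_costC.
- by move=> l; rewrite /swap_cost !subrr !mul0r.
- by move=> l m ? ? ? ?; rewrite swap_cost_tpermD.
- move=> l li lj; rewrite swap_cost_tpermL// swap_cost_tpermR//.
  have -> : - swap_cost x y p i j =
      ((y i - y l) - (y j - y l)) * ((x (p j) - x (p l)) - (x (p i) - x (p l))).
    by rewrite /swap_cost; ring.
  have := @expR_second_difference R (y j - y l) (y i - y l)
    (x (p i) - x (p l)) (x (p j) - x (p l)).
  have hy : y j - y l <= y i - y l by have := yd i j (ltnW ij); lra.
  have hx : x (p i) - x (p l) <= x (p j) - x (p l).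
    by have := xd (p j) (p i) (ltnW pji); lra.
  by move=> /(_ hy hx); rewrite /f /swap_cost; lra.
- rewrite swap_cost_tperm_pair /f opprK.
  move: t0; set t := swap_cost x y p i j => t0.
  have : expR t <= expR (- t) by rewrite ler_expR; lra.
  by lra.
Qed.

End SortingBounds.

(** * Sequences with powers of gaps *)

Section Gaps.
Context {R : realType} {n : nat}.
Implicit Types (x y : 'I_n.+1 -> R) (p : 'S_n.+1) (i j : 'I_n.+1).

Definition gap x (l : nat) : R := x (inord l) - x (inord l.+1).

(* The decreasing sequence whose gaps are the [M]-th powers of those of [x]. *)
Definition gap_pow (M : nat) x i : R := \sum_(i <= l < n) gap x l ^+ M.

Lemma gap_ge0 x l : nonincr x -> (l < n)%N -> 0 <= gap x l.
Proof.
by move=> xd ln; rewrite subr_ge0; apply: xd; rewrite !inordK// ltnW.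
Qed.

Lemma sum_gap x i j : (i <= j)%N -> x i - x j = \sum_(i <= l < j) gap x l.
Proof.
move=> ij; rewrite -[in LHS](inord_val i) -[in LHS](inord_val j).
rewrite (eq_bigr (fun l => (- x (inord l.+1)) - (- x (inord l)))); last first.
  by move=> l _; rewrite /gap; ring.
by rewrite telescope_sumr// opprK addrC.
Qed.

Lemma gap_powB M x i j : (i <= j)%N ->
  gap_pow M x i - gap_pow M x j = \sum_(i <= l < j) gap x l ^+ M.
Proof.
move=> ij; have jn : (j <= n)%N by rewrite -ltnS.
by rewrite /gap_pow (big_cat_nat ij jn)/= addrK.
Qed.

Lemma gap_pow_nonincr M x : nonincr x -> nonincr (gap_pow M x).
Proof.
move=> xd i j ij; rewrite -subr_ge0 gap_powB//.
rewrite big_nat; apply: sumr_ge0 => l /andP[_ lj].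
by apply/exprn_ge0/gap_ge0 => //; apply: leq_trans lj _; rewrite -ltnS.
Qed.

Lemma gap_powB_le M x i j : nonincr x -> (i <= j)%N ->
  gap_pow M x i - gap_pow M x j <= n%:R * (x i - x j) ^+ M.
Proof.
move=> xd ij; rewrite gap_powB//.
have jn : (j <= n)%N by rewrite -ltnS.
apply: (@le_trans _ _ (\sum_(i <= l < j) (x i - x j) ^+ M)).
  rewrite big_nat [leRHS]big_nat; apply: ler_sum => l /andP[il lj].
  have ln : (l < n)%N by apply: leq_trans lj _.
  apply: lerXn2r; rewrite ?nnegrE ?gap_ge0// ?subr_ge0 ?xd//.
  by apply: lerB; apply: xd; rewrite inordK// ltnW.
rewrite big_const_nat iter_addr_0 -[leLHS]mulr_natl ler_wpM2r//.
  by rewrite exprn_ge0// subr_ge0 xd.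
by rewrite ler_nat (leq_trans (leq_subr _ _)).
Qed.

Lemma gap_powZ M x (s : R) i : gap_pow M (fun i => s * x i) i = s ^+ M * gap_pow M x i.
Proof.
rewrite /gap_pow big_distrr/=; apply: eq_bigr => l _.
by rewrite /gap -mulrBr exprMn.
Qed.

(** Scaling [x] by [s] turns each summand into [4 s z / (1 + s z)^2], whose integral over [(0, 1]]
    for [ds / s] is at most 4, whatever [z >= 0] is. *)
Definition gap_error x y : R :=
  \sum_(0 <= l < n) \sum_(0 <= m < n)
    (fun z => 4 * z / (1 + z) ^+ 2) (gap y l * gap x m).

(** For [z >= 1] the power dominates; for [z <= 1] the factor [4 / (1 + z)^2] is at least 1. *)
Lemma le_pow_error (z : R) M : 0 <= z -> (0 < M)%N ->
  z <= z ^+ M + 4 * z / (1 + z) ^+ 2.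
Proof.
move=> z0 M0; have z1 : 0 < (1 + z) ^+ 2 by apply: exprn_gt0; rewrite ltr_pwDl.
have e0 : 0 <= 4 * z / (1 + z) ^+ 2 
  by apply: divr_ge0; [exact: mulr_ge0|exact: ltW].
have [zle|zge] := leP z 1; last first.
  rewrite (le_trans _ (lerD (lexx _) e0))// addr0.
  by rewrite -[leLHS]expr1 ler_weXn2l// ltW.
apply: (@le_trans _ _ (4 * z / (1 + z) ^+ 2)); last by rewrite lerDr exprn_ge0.
by rewrite ler_pdivlMr// [leRHS]mulrC ler_wpM2l//; nra.
Qed.

Lemma sum_nat_sub_le (F : nat -> R) a b N : (b <= N)%N ->
  (forall l, (l < N)%N -> 0 <= F l) ->
  \sum_(a <= l < b) F l <= \sum_(0 <= l < N) F l.
Proof.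
move=> bN F0; rewrite (big_nat_widenl _ 0)//= (big_nat_widen _ _ _ _ _ bN)/=.
rewrite big_mkcond/= big_nat [leRHS]big_nat.
by apply: ler_sum => l /andP[_ lN]; case: ifP => // _; exact: F0.
Qed.

(** An exchange lowers the cost by a sum of products of gaps over a rectangle of indices, so
    [le_pow_error] applies termwise at the price of one [gap_error]. Each exchange fixes a further
    point, hence at most [n.+1] errors. *)
Lemma cost_le_gap_pow M x y p : nonincr x -> nonincr y -> (0 < M)%N ->
  cost x y p <= cost (gap_pow M x) (gap_pow M y) p + n.+1%:R * gap_error x y.
Proof.
move=> xd yd M0.
have e0 (z : R) : 0 <= z -> 0 <= 4 * z / (1 + z) ^+ 2.
  by move=> z0; apply: divr_ge0; [exact: mulr_ge0|rewrite exprn_ge0// addr_ge0].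
have g0 l m : (l < n)%N -> (m < n)%N -> 0 <= gap y l * gap x m.
  by move=> ln mn; rewrite mulr_ge0 ?gap_ge0.
have err0 : 0 <= gap_error x y.
  rewrite /gap_error big_nat; apply: sumr_ge0 => l ln.
  by rewrite big_nat; apply: sumr_ge0 => m mn; rewrite e0// g0.
suff : cost x y p <= cost (gap_pow M x) (gap_pow M y) p + (moved p)%:R * gap_error x y.
  move=> H; apply: le_trans H _; rewrite lerD2l ler_wpM2r// ler_nat.
  by rewrite (leq_trans (max_card _))// card_ord.
elim/perm_sort_ind: p => [|p i j ij pji mlt IH].
  by rewrite !cost1 add0r mulr_ge0.
have := cost_tperm x y p i j.
have := cost_tperm (gap_pow M x) (gap_pow M y) p i j.
set t := swap_cost x y p i j; set t' := swap_cost _ _ p i j => costE' costE.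
have mle : (moved (tperm i j * p)%g)%:R + 1 <= (moved p)%:R :> R.
  by rewrite natr1 ler_nat.
have merr : ((moved (tperm i j * p)%g)%:R + 1) * gap_error x y <=
    (moved p)%:R * gap_error x y by rewrite ler_wpM2r.
suff : - t <= - t' + gap_error x y by lra.
have jn : (j <= n)%N by rewrite -ltnS.
have pn : (p i <= n)%N by rewrite -ltnS.
have -> : - t' = \sum_(i <= l < j) \sum_(p j <= m < p i) (gap y l * gap x m) ^+ M.
  rewrite /t' /swap_cost (gap_powB M y (ltnW ij)) -mulrN opprB (gap_powB M x (ltnW pji)).
  rewrite big_distrlr/=; apply: eq_bigr => l _; apply: eq_bigr => m _.
  by rewrite exprMn.
have -> : - t = \sum_(i <= l < j) \sum_(p j <= m < p i) gap y l * gap x m.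
  rewrite /t /swap_cost (sum_gap y (ltnW ij)) -mulrN opprB (sum_gap x (ltnW pji)).
  by rewrite big_distrlr.
have : \sum_(i <= l < j) \sum_(p j <= m < p i)
    (fun z => 4 * z / (1 + z) ^+ 2) (gap y l * gap x m) <= gap_error x y.
  apply: (@le_trans _ _ (\sum_(0 <= l < n) \sum_(p j <= m < p i)
    (fun z => 4 * z / (1 + z) ^+ 2) (gap y l * gap x m))).
    apply: sum_nat_sub_le => // l ln; rewrite big_nat.
    by apply: sumr_ge0 => m /andP[_ mp]; rewrite e0// g0// (leq_trans mp).
  rewrite /gap_error big_nat [leRHS]big_nat; apply: ler_sum => l ln.
  by apply: sum_nat_sub_le => // m mn; rewrite e0// g0.
move=> err; apply: le_trans (lerD (lexx _) err).
rewrite -big_split/= big_nat [leRHS]big_nat; apply: ler_sum => l /andP[_ lj].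
rewrite -big_split/= big_nat [leRHS]big_nat; apply: ler_sum => m /andP[_ mp].
by apply: le_pow_error => //; rewrite g0// (leq_trans lj, leq_trans mp).
Qed.

End Gaps.

(** * The radial system *)

Section RadialSystem.
Context {R : realType} {n : nat}.
Implicit Types (x y : 'I_n.+1 -> R) (p : 'S_n.+1) (i j : 'I_n.+1).

(** The double sum visits each pair twice and has zero diagonal, hence [k / 2]. *)
Definition radial_system (k : R) x y (G dG : 'S_n.+1 -> R -> R) : Prop :=
  [/\ forall p, {within `[0, 1], continuous (G p)},
      forall p, G p 0 = 1,
      forall p (s : R), 0 < s <= 1 -> is_derive s 1 (G p) (dG p s) &
      forall p (s : R), 0 < s <= 1 -> s * dG p s = - (s * cost x y p) * G p s +
        k / 2 * \sum_i \sum_j (G (tperm i j * p)%g s - G p s)].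

(** Twice the logarithm of [prod_(i < j) (1 + p_ij)]. *)
Definition log_weight x y : R :=
  \sum_i \sum_j ln (1 + swap_cost x y 1%g i j).

Lemma swap_costZ (s : R) x y p i j :
  swap_cost (fun i => s * x i) y p i j = s * swap_cost x y p i j.
Proof. by rewrite /swap_cost -mulrBr; ring. Qed.

Lemma costZ (s : R) x y p : cost (fun i => s * x i) y p = s * cost x y p.
Proof.
by rewrite /cost big_distrr/=; apply: eq_bigr => i _; rewrite -mulrBr mulrA.
Qed.

Lemma nonincrZ (s : R) x : 0 <= s -> nonincr x -> nonincr (fun i => s * x i).
Proof. by move=> s0 xd i j ij; rewrite ler_wpM2l// xd. Qed.

Lemma radial_system_le_super (k : R) x y G dG (V dV : 'S_n.+1 -> R -> R) :
  0 <= k -> nonincr x -> nonincr y -> radial_system k x y G dG ->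
  (forall p, {within `[0, 1], continuous (V p)}) ->
  (forall p, 1 <= V p 0) ->
  (forall p (s : R), 0 < s <= 1 -> is_derive s 1 (V p) (dV p s)) ->
  (forall p (s : R), 0 < s <= 1 -> - (s * cost x y p) * V p s +
        k / 2 * \sum_i \sum_j (V (tperm i j * p)%g s - V p s) <= s * dV p s) ->
  forall p, G p 1 <= V p 1.
Proof.
move=> k0 xd yd [cG G0 dGP Gsys] cV V0 dVP Vsys p; rewrite -subr_ge0.
apply: (@cooperative_system_ge0 R _ ('I_n.+1 * 'I_n.+1)%type
  (fun ij p => tperm ij.1 ij.2 * p)%g (k / 2) (fun p s => V p s - G p s)
  (fun p s => dV p s - dG p s) (fun p s => s * cost x y p)) => //.
- by rewrite divr_ge0.
- by move=> q s /andP[/ltW s0 _]; rewrite mulr_ge0// cost_ge0.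
- by move=> q t; apply: cvgB; [exact: cV|exact: cG].
- by move=> q; rewrite subr_ge0 G0.
- by move=> q s s1; apply: is_derive_addf (dVP q s s1) (is_derive_oppf (dGP q s s1)).
move=> q s s1; rewrite /= [leRHS]mulrBr Gsys//; have := Vsys q s s1.
have -> : \sum_(ij : 'I_n.+1 * 'I_n.+1) (V (tperm ij.1 ij.2 * q)%g s -
    G (tperm ij.1 ij.2 * q)%g s - (V q s - G q s)) =
    \sum_i \sum_j (V (tperm i j * q)%g s - V q s) -
    \sum_i \sum_j (G (tperm i j * q)%g s - G q s).
  by rewrite !pair_bigA -sumrB; apply: eq_bigr => ij _; ring.
by lra.
Qed.

Lemma radial_system_ge_sub (k : R) x y G dG (U dU : 'S_n.+1 -> R -> R) :
  0 <= k -> nonincr x -> nonincr y -> radial_system k x y G dG ->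
  (forall p, {within `[0, 1], continuous (U p)}) ->
  (forall p, U p 0 <= 1) ->
  (forall p (s : R), 0 < s <= 1 -> is_derive s 1 (U p) (dU p s)) ->
  (forall p (s : R), 0 < s <= 1 -> s * dU p s <= - (s * cost x y p) * U p s +
        k / 2 * \sum_i \sum_j (U (tperm i j * p)%g s - U p s)) ->
  forall p, U p 1 <= G p 1.
Proof.
move=> k0 xd yd [cG G0 dGP Gsys] cU U0 dUP Usys p; rewrite -subr_ge0.
apply: (@cooperative_system_ge0 R _ ('I_n.+1 * 'I_n.+1)%type
  (fun ij p => tperm ij.1 ij.2 * p)%g (k / 2) (fun p s => G p s - U p s)
  (fun p s => dG p s - dU p s) (fun p s => s * cost x y p)) => //.
- by rewrite divr_ge0.
- by move=> q s /andP[/ltW s0 _]; rewrite mulr_ge0// cost_ge0.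
- by move=> q t; apply: cvgB; [exact: cG|exact: cU].
- by move=> q; rewrite subr_ge0 G0.
- by move=> q s s1; apply: is_derive_addf (dGP q s s1) (is_derive_oppf (dUP q s s1)).
move=> q s s1; rewrite /= [leRHS]mulrBr Gsys//; have := Usys q s s1.
have -> : \sum_(ij : 'I_n.+1 * 'I_n.+1) (G (tperm ij.1 ij.2 * q)%g s -
    U (tperm ij.1 ij.2 * q)%g s - (G q s - U q s)) =
    \sum_i \sum_j (G (tperm i j * q)%g s - G q s) -
    \sum_i \sum_j (U (tperm i j * q)%g s - U q s).
  by rewrite !pair_bigA -sumrB; apply: eq_bigr => ij _; ring.
by lra.
Qed.

Lemma sum2_cst (c : R) : \sum_(i < n.+1) \sum_(j < n.+1) c = n.+1%:R ^+ 2 * c.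
Proof. by rewrite !sumr_const card_ord -mulrnA -[LHS]mulr_natl natrM expr2. Qed.

(** The supersolution inequality divided by the supersolution. For [c <= 1] the sum is sorted and
    [1 + z] is replaced by [1 + c + z]; for [c > 1] it suffices that [z / (1 + z) <= c] and
    [z / (1 + c + z) >= - c]. In [B], the term with 8 pays for sorting and [n.+1%:R ^+ 2] for the
    termwise losses. *)
Lemma super_inequality (k B : R) x y p (c := cost x y p) :
  0 < k -> nonincr x -> nonincr y ->
  1 + k * (8 * (n.+1%:R + 1) + n.+1%:R ^+ 2) <= B ->
  c / (1 + c) + k / 2 * \sum_i \sum_j (fun z => z / (1 + z)) (swap_cost x y 1%g i j) <=
  B * c + k / 2 * \sum_i \sum_j (fun z => z / (1 + c + z)) (swap_cost x y p i j).
Proof.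
move=> k0 xd yd hB.
have c0 : 0 <= c by exact: cost_ge0.
have ccle : c / (1 + c) <= c.
  by rewrite ler_pdivrMr; [nra|lra].
have N0 : 0 <= n.+1%:R :> R by [].
have k2 : 0 <= k / 2 by lra.
have Bc : (1 + k * (8 * (n.+1%:R + 1) + n.+1%:R ^+ 2)) * c <= B * c.
  by rewrite ler_wpM2r.
have p0 i j : 0 <= swap_cost x y 1%g i j by exact: swap_cost1_ge0.
have [c1|c1] := leP c 1.
  have H := @rational_sorting_bound R _ x y c p xd yd.
  move: H; rewrite c0 c1 lexx => /(_ isT isT) H.
  have : \sum_i \sum_j (fun z => z / (1 + z)) (swap_cost x y 1%g i j) <=
      \sum_i \sum_j (fun z => z / (1 + c + z)) (swap_cost x y 1%g i j) + n.+1%:R ^+ 2 * c.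
    rewrite -sum2_cst -big_split/=; apply: ler_sum => i _.
    rewrite -big_split/=; apply: ler_sum => j _.
    have z0 := p0 i j; set z := swap_cost x y 1%g i j in z0 *.
    rewrite -subr_ge0.
    have -> : z / (1 + c + z) + c - z / (1 + z) =
        c * ((1 + c + z) * (1 + z) - z) / ((1 + c + z) * (1 + z)).
      field; apply/andP; split; apply: lt0r_neq0; lra.
    by apply: divr_ge0; apply: mulr_ge0; nra.
  move=> H2; have := ler_wpM2l k2 (le_trans H2 (lerD H (lexx _))).
  rewrite -/c; set S1 := \sum_i _; set S2 := \sum_i _.
  have : 0 <= k * n.+1%:R ^+ 2 * c by rewrite !mulr_ge0// ltW.
  by move: (n.+1%:R : R) (c / (1 + c)) Bc ccle => N cc; lra.
have h1 : \sum_i \sum_j (fun z => z / (1 + z)) (swap_cost x y 1%g i j) <= n.+1%:R ^+ 2 * c.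
  rewrite -sum2_cst; apply: ler_sum => i _; apply: ler_sum => j _.
  by have z0 := p0 i j; rewrite ler_pdivrMr; nra.
have h2 : - (n.+1%:R ^+ 2 * c) <= \sum_i \sum_j (fun z => z / (1 + c + z)) (swap_cost x y p i j).
  rewrite -mulrN -sum2_cst; apply: ler_sum => i _; apply: ler_sum => j _.
  have zc := @swap_cost_ge R _ x y p i j xd yd; rewrite -/c in zc.
  by rewrite ler_pdivlMr; nra.
have := ler_wpM2l k2 h1; have := ler_wpM2l k2 h2.
have : 0 <= k * (8 * (n.+1%:R + 1)) * c by rewrite !mulr_ge0// ltW.
by nra.
Qed.

Lemma is_derive_ln_affine (a t : R) : 0 <= a -> 0 <= t ->
  is_derive t 1 (fun t : R => ln (1 + a * t)) (a / (1 + a * t)).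
Proof.
move=> a0 t0; apply: is_derive_lnf.
  by rewrite ltr_pwDl// mulr_ge0.
have H := is_derive_addf (is_derive_cst (1 : R) t (1 : R))
  (is_derive_scalef a (is_derive_id t 1)).
by apply: (is_derive_eq H); ring.
Qed.

Lemma radial_system_upper (k : R) : 0 < k -> exists2 C : R, 0 < C &
  forall x y G dG, nonincr x -> nonincr y -> radial_system k x y G dG ->
  forall p, G p 1 <= C * expR (- (k / 2 * log_weight x y)).
Proof.
move=> k0; pose B : R := 1 + k * (8 * (n.+1%:R + 1) + n.+1%:R ^+ 2).
have B1 : 1 <= B by rewrite /B lerDl !mulr_ge0 ?addr_ge0 ?mulr_ge0// ltW.
have B0 : 0 < B by apply: lt_le_trans B1.
(* With this choice the killing rate [s c_p] is [B] times the cost of [th * s * x], the quantity in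
   [super_inequality]. *)
pose th := B^-1; have th0 : 0 < th by rewrite invr_gt0.
have th1 : th <= 1 by rewrite invf_le1.
exists (expR (k / 2 * (n.+1%:R ^+ 2 * - ln th))); first exact: expR_gt0.
move=> x y G dG xd yd sys p.
have p0 i j : 0 <= swap_cost x y 1%g i j by exact: swap_cost1_ge0.
have c0 q : 0 <= cost x y q by exact: cost_ge0.
have thp0 i j : 0 <= th * swap_cost x y 1%g i j by rewrite mulr_ge0// ltW.
have thc0 q : 0 <= th * cost x y q by rewrite mulr_ge0// ltW.
pose L q (s : R) := - ln (1 + th * cost x y q * s) -
  k / 2 * \sum_i \sum_j ln (1 + th * swap_cost x y 1%g i j * s).
pose dL q (s : R) := - (th * cost x y q / (1 + th * cost x y q * s)) -
  k / 2 * \sum_i \sum_j (th * swap_cost x y 1%g i j / (1 + th * swap_cost x y 1%g i j * s)).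
have dLP q (s : R) : 0 <= s -> is_derive s 1 (L q) (dL q s).
  move=> s0; apply: is_derive_addf.
    by apply: is_derive_oppf; exact: is_derive_ln_affine.
  apply: is_derive_oppf; apply: is_derive_scalef.
  apply: is_derive_sumf => i; apply: is_derive_sumf => j.
  exact: is_derive_ln_affine.
have dVP q (s : R) : 0 <= s -> is_derive s 1 (fun s => expR (L q s)) (dL q s * expR (L q s)).
  by move=> s0; apply: is_derive_expRf; exact: dLP.
have GV : G p 1 <= expR (L p 1).
  have dVP' q (s : R) : 0 < s <= 1 ->
      is_derive s 1 (fun s => expR (L q s)) (dL q s * expR (L q s)).
    by move=> /andP[/ltW s0 _]; exact: dVP.
  refine (radial_system_le_super (ltW k0) xd yd sys _ _ dVP' _ p).
  - move=> q; apply: continuous_in_subspaceT => s; rewrite inE/= in_itv/= => /andP[s0 _].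
    exact: is_derive_continuous (dVP q s s0).
  - move=> q; rewrite -expR0 ler_expR /L mulr0 addr0 ln1 oppr0 sub0r.
    rewrite big1 ?mulr0 ?oppr0// => i _; rewrite big1// => j _.
    by rewrite mulr0 addr0 ln1.
  move=> q s /andP[s0 _].
  have V0 := expR_gt0 (L q s).
  pose x' i := th * s * x i.
  have ts0 : 0 <= th * s by rewrite mulr_ge0 ?ltW.
  have xd' : nonincr x' by exact: nonincrZ.
  have cE r : th * cost x y r * s = cost x' y r by rewrite costZ; ring.
  have pE r i j : th * swap_cost x y r i j * s = swap_cost x' y r i j.
    by rewrite swap_costZ; ring.
  have c'0 r : 0 <= cost x' y r by exact: cost_ge0.
  (* The product over pairs does not depend on the permutation, so an exchange only multiplies [V]
     by [(1 + c) / (1 + c + z)]. *)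
  have VE i j : expR (L (tperm i j * q)%g s) = expR (L q s) *
      (1 - (fun z => z / (1 + cost x' y q + z)) (swap_cost x' y q i j)).
    have a1 : 0 < 1 + cost x' y q + swap_cost x' y q i j.
      by have := swap_cost_ge q i j xd' yd; lra.
    have a2 : 0 < 1 + cost x' y q by rewrite ltr_pwDl.
    rewrite /L !cE cost_tperm addrA !expRD [RHS]mulrAC; congr (_ * _).
    rewrite !expRN !lnK ?posrE//.
    by field; apply/andP; split; apply: lt0r_neq0.
  rewrite (eq_bigr (fun i => \sum_j - (expR (L q s) *
      (fun z => z / (1 + cost x' y q + z)) (swap_cost x' y q i j)))); last first.
    move=> i _; apply: eq_bigr => j _; rewrite VE; ring.
  under eq_bigr do rewrite sumrN -mulr_sumr.
  rewrite sumrN -mulr_sumr.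
  have := @super_inequality k B x' y q k0 xd' yd (lexx _).
  set S1 := \sum_i \sum_j _; set S2 := \sum_i \sum_j _ => H.
  have -> : s * (dL q s * expR (L q s)) =
      - (cost x' y q / (1 + cost x' y q) + k / 2 * S1) * expR (L q s).
    rewrite mulrA; congr (_ * _); rewrite /dL mulrBr mulrN opprD; congr (_ - _).
      by rewrite cE -(cE q); congr (- _); ring.
    rewrite mulrCA; congr (_ * _); rewrite mulr_sumr; apply: eq_bigr => i _.
    by rewrite mulr_sumr; apply: eq_bigr => j _; rewrite pE -pE; ring.
  have -> : s * cost x y q = B * cost x' y q.
    by rewrite costZ /th mulrA mulrA divff ?mul1r// gt_eqF.
  have -> : - (B * cost x' y q) * expR (L q s) + k / 2 * - (expR (L q s) * S2) =
      - (B * cost x' y q + k / 2 * S2) * expR (L q s) by ring.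
  by apply: ler_wpM2r; [exact: ltW|rewrite lerN2].
apply: le_trans GV _; rewrite -expRD ler_expR /L.
have l0 : 0 <= ln (1 + th * cost x y p * 1).
  by apply: ln_ge0; rewrite mulr1 lerDl.
(* Since [th <= 1], [1 + th p_ij >= th (1 + p_ij)]: each pair loses a factor [th], which is where
   the constant comes from. *)
suff : log_weight x y + n.+1%:R ^+ 2 * ln th <=
    \sum_i \sum_j ln (1 + th * swap_cost x y 1%g i j * 1).
  move=> H; have k2 : 0 <= k / 2 by lra.
  have := ler_wpM2l k2 H; rewrite mulrDr !mulrN; lra.
rewrite -sum2_cst -big_split/=; apply: ler_sum => i _.
rewrite -big_split/=; apply: ler_sum => j _.
have a1 : 0 < 1 + swap_cost x y 1%g i j by rewrite ltr_pwDl.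
rewrite -lnM ?posrE// ler_ln ?posrE ?mulr_gt0//.
  by have := p0 i j; nra.
by rewrite mulr1 ltr_pwDl.
Qed.

End RadialSystem.

(** * The subsolution and the lower bound *)

Section RadialLower.
Context {R : realType} {n : nat}.
Implicit Types (x y : 'I_n.+1 -> R) (p : 'S_n.+1) (i j : 'I_n.+1).

(** The subsolution inequality divided by the subsolution. Passing to gap powers leaves the term
    with [gap_error]; the factor [M] pays for the cost [c] and for sorting [1 - exp(- z)], which
    loses [k * (n.+1 + 1) * c]. *)
Lemma sub_inequality (k : R) (M : nat) x y p
    (c := cost (gap_pow M x) (gap_pow M y) p) :
  0 < k -> nonincr x -> nonincr y -> (0 < M)%N -> 1 + k * (n.+1%:R + 1) <= M%:R ->
  cost x y p + k / 2 * \sum_i \sum_j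
    (fun z => 1 - expR (- z)) (swap_cost (gap_pow M x) (gap_pow M y) p i j) <=
  M%:R * c + k / 2 * \sum_i \sum_j
    (fun z => z / (1 + z) + 2 * z / (1 + z) ^+ 2)
      (swap_cost (gap_pow M x) (gap_pow M y) 1%g i j) + n.+1%:R * gap_error x y.
Proof.
move=> k0 xd yd M0 hM.
have xd' := gap_pow_nonincr M xd; have yd' := gap_pow_nonincr M yd.
have c0 : 0 <= c by exact: cost_ge0.
have k2 : 0 <= k / 2 by lra.
have H1 := cost_le_gap_pow p xd yd M0.
have H2 := ler_wpM2l k2 (expR_sorting_bound p xd' yd').
(* The right summand is [1 + (z - 1) / (1 + z)^2], which exceeds 1 for [z >= 1]; for [z < 1] the
   inequality [exp(- z) >= 1 - z] suffices. *)
have H3 : \sum_i \sum_j (fun z => 1 - expR (- z))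
      (swap_cost (gap_pow M x) (gap_pow M y) 1%g i j) <=
    \sum_i \sum_j (fun z => z / (1 + z) + 2 * z / (1 + z) ^+ 2)
      (swap_cost (gap_pow M x) (gap_pow M y) 1%g i j).
  apply: ler_sum => i _; apply: ler_sum => j _.
  have z0 := swap_cost1_ge0 i j xd' yd'.
  set z := swap_cost _ _ _ i j in z0 *.
  have z1 : 0 < 1 + z by lra.
  have -> : z / (1 + z) + 2 * z / (1 + z) ^+ 2 = 1 + (z - 1) / (1 + z) ^+ 2.
    by field; apply: lt0r_neq0.
  have [zge|zlt] := leP 1 z.
    have : 0 <= (z - 1) / (1 + z) ^+ 2 by apply: divr_ge0; [lra|exact: sqr_ge0].
    by have := expR_gt0 (- z); lra.
  have e1 : (1 - z) / (1 + z) ^+ 2 <= 1 - z.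
    by rewrite ler_pdivrMr ?exprn_gt0//; nra.
  have -> : (z - 1) / (1 + z) ^+ 2 = - ((1 - z) / (1 + z) ^+ 2).
    by rewrite -mulNr opprB.
  by have := expR_ge1Dx (- z); lra.
have {}H3 := ler_wpM2l k2 H3.
have H4 : (1 + k * (n.+1%:R + 1)) * c <= M%:R * c by rewrite ler_wpM2r.
move: H1 H2 H3 H4; rewrite -/c.
move: (n.+1%:R : R) (\sum_i \sum_j _) (\sum_i \sum_j _) (\sum_i \sum_j _) => N S1 S2 S3.
by lra.
Qed.

(* An antiderivative of [z / (1 + z) ^+ 2] for the measure [dz / z], vanishing at 0;
   it equals [z / (1 + z)]. *)
Definition bounded_log (z : R) : R := 1 - expR (- ln (1 + z)).

Lemma bounded_log_itv z : 0 <= z -> 0 <= bounded_log z <= 1.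
Proof.
move=> z0; rewrite /bounded_log subr_ge0 -[X in _ <= X]expR0 ler_expR oppr_le0.
by rewrite ln_ge0 ?lerDl//= gerBl ltW// expR_gt0.
Qed.

Lemma is_derive_monomial (a t : R) M :
  is_derive t 1 (fun t : R => a * t ^+ M) (a * (M%:R * t ^+ M.-1)).
Proof.
apply: is_derive_scalef; have H := is_deriveX M (is_derive_id t (1 : R)).
rewrite (_ : (fun t => _) = (id : R -> R) ^+ M); last by apply/funext => u; rewrite exprfctE.
by apply: (is_derive_eq H); rewrite -[LHS]/(_ * 1) mulr1 mulr_natl.
Qed.

Lemma is_derive_ln_monomial (a t : R) M : 0 <= a -> 0 <= t ->
  is_derive t 1 (fun t : R => ln (1 + a * t ^+ M))
    (a * (M%:R * t ^+ M.-1) / (1 + a * t ^+ M)).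
Proof.
move=> a0 t0; apply: is_derive_lnf.
  by rewrite ltr_pwDl// mulr_ge0// exprn_ge0.
have H := is_derive_addf (is_derive_cst (1 : R) t (1 : R)) (is_derive_monomial a t M).
by apply: (is_derive_eq H); rewrite add0r.
Qed.

Lemma is_derive_bounded_log (a t : R) M : 0 <= a -> 0 <= t ->
  is_derive t 1 (fun t : R => bounded_log (a * t ^+ M))
    (a * (M%:R * t ^+ M.-1) / (1 + a * t ^+ M) ^+ 2).
Proof.
move=> a0 t0; have z0 : 0 < 1 + a * t ^+ M by rewrite ltr_pwDl// mulr_ge0// exprn_ge0.
have H := is_derive_addf (is_derive_cst (1 : R) t (1 : R)) (is_derive_oppf
  (is_derive_expRf (is_derive_oppf (is_derive_ln_monomial M a0 t0)))).
apply: (is_derive_eq H); rewrite expRN lnK ?posrE//.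
by field; apply: lt0r_neq0.
Qed.

Lemma gap_errorE (s : R) x y : gap_error (fun i => s * x i) y =
  \sum_(0 <= l < n) \sum_(0 <= m < n)
    (4 * (s * (gap y l * gap x m)) / (1 + s * (gap y l * gap x m)) ^+ 2).
Proof.
rewrite /gap_error; apply: eq_bigr => l _; apply: eq_bigr => m _.
by rewrite -[gap _ m]/(s * _ - s * _) -mulrBr (mulrCA (gap y l) s).
Qed.

(** The subsolution is positive, which gives the first claim; the second is read off at the
    identity, where the cost vanishes. *)
Lemma radial_system_lower (k : R) : 0 < k -> exists2 C : R, 0 < C &
  forall x y G dG, nonincr x -> nonincr y -> radial_system k x y G dG ->
  (forall p, 0 <= G p 1) /\
  C * expR (- (k / 2 * log_weight x y)) <= G 1%g 1.
Proof.
move=> k0.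
have [M M0 hM] : exists2 M, (0 < M)%N & 1 + k * (n.+1%:R + 1) <= M%:R.
  exists (Num.bound (1 + k * (n.+1%:R + 1))).+1 => //.
  have a0 : 0 <= 1 + k * (n.+1%:R + 1) by rewrite addr_ge0// mulr_ge0// ltW.
  by apply: le_trans (ltW (archi_boundP a0)) _; rewrite ler_nat leqnSn.
have Mr0 : 0 < M%:R :> R by rewrite ltr0n.
pose N : R := n.+1%:R; pose n2 : R := n%:R.
have k2 : 0 <= k / 2 by lra.
exists (expR (- (k / 2 * (N ^+ 2 * (ln (1 + n2 ^+ 2) + 2)) + 4 * N * n2 ^+ 2))).
  exact: expR_gt0.
move=> x y G dG xd yd sys.
pose X := gap_pow M x; pose Y := gap_pow M y.
have Xd : nonincr X := gap_pow_nonincr M xd.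
have Yd : nonincr Y := gap_pow_nonincr M yd.
have p0 i j : 0 <= swap_cost X Y 1%g i j by exact: swap_cost1_ge0.
have g0 l m : (l < n)%N -> (m < n)%N -> 0 <= gap y l * gap x m.
  by move=> ln mn; rewrite mulr_ge0 ?gap_ge0.
pose g (l m : 'I_n) := gap y l * gap x m.
have gg0 l m : 0 <= g l m by exact: g0.
(* Applying [s d/ds] to a function of [s ^+ M] yields a factor [M]: [M%:R^-1] cancels it in the
   product over pairs, while in the cost term it survives and absorbs the losses. The last sum
   integrates [gap_error]; [s ^+ 1] matches [is_derive_bounded_log]. *)
pose L q (s : R) := - (cost X Y q * s ^+ M) -
  k / 2 * (M%:R^-1 * \sum_i \sum_j (ln (1 + swap_cost X Y 1%g i j * s ^+ M) +
    2 * bounded_log (swap_cost X Y 1%g i j * s ^+ M))) -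
  N * \sum_l \sum_m 4 * bounded_log (g l m * s ^+ 1).
pose dL q (s : R) := - (cost X Y q * (M%:R * s ^+ M.-1)) -
  k / 2 * (M%:R^-1 * \sum_i \sum_j
    (swap_cost X Y 1%g i j * (M%:R * s ^+ M.-1) / (1 + swap_cost X Y 1%g i j * s ^+ M) +
    2 * (swap_cost X Y 1%g i j * (M%:R * s ^+ M.-1) /
      (1 + swap_cost X Y 1%g i j * s ^+ M) ^+ 2))) -
  N * \sum_l \sum_m 4 * (g l m * (1%:R * s ^+ 0) / (1 + g l m * s ^+ 1) ^+ 2).
have dLP q (s : R) : 0 <= s -> is_derive s 1 (L q) (dL q s).
  move=> s0; apply: is_derive_addf.
    apply: is_derive_addf.
      by apply: is_derive_oppf; exact: is_derive_monomial.
    apply: is_derive_oppf; apply: is_derive_scalef; apply: is_derive_scalef.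
    apply: is_derive_sumf => i; apply: is_derive_sumf => j.
    apply: is_derive_addf; first exact: is_derive_ln_monomial.
    by apply: is_derive_scalef; exact: is_derive_bounded_log.
  apply: is_derive_oppf; apply: is_derive_scalef.
  apply: is_derive_sumf => l; apply: is_derive_sumf => m.
  by apply: is_derive_scalef; exact: is_derive_bounded_log.
have dUP q (s : R) : 0 <= s -> is_derive s 1 (fun s => expR (L q s)) (dL q s * expR (L q s)).
  by move=> s0; apply: is_derive_expRf; exact: dLP.
have bl0 : bounded_log 0 = 0 by rewrite /bounded_log addr0 ln1 oppr0 expR0 subrr.
have UG q : expR (L q 1) <= G q 1.
  have dUP' r (s : R) : 0 < s <= 1 ->
      is_derive s 1 (fun s => expR (L r s)) (dL r s * expR (L r s)).
    by move=> /andP[/ltW s0 _]; exact: dUP.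
  refine (radial_system_ge_sub (ltW k0) xd yd sys _ _ dUP' _ q).
  - move=> r; apply: continuous_in_subspaceT => s; rewrite inE/= in_itv/= => /andP[s0 _].
    exact: is_derive_continuous (dUP r s s0).
  - move=> r; rewrite -[leRHS]expR0 ler_expR /L expr1 !expr0n eqn0Ngt M0/= mulr0 oppr0 sub0r.
    rewrite big1 ?mulr0 ?oppr0 ?sub0r; last first.
      by move=> i _; rewrite big1// => j _; rewrite mulr0 addr0 ln1 bl0 mulr0 addr0.
    rewrite big1 ?mulr0 ?oppr0// => i _; rewrite big1// => j _.
    by rewrite mulr0 bl0 mulr0.
  move=> r s /andP[s0 _].
  have U0 := expR_gt0 (L r s).
  (* Gap powers of [x'] are [s ^+ M] times those of [x], so [sub_inequality] for [x'] and [y] is the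
     inequality at time [s]. *)
  pose x' i := s * x i.
  have xd' : nonincr x' by apply: nonincrZ => //; exact: ltW.
  have XE i : gap_pow M x' i = s ^+ M * X i by exact: gap_powZ.
  have XE' : gap_pow M x' = (fun i => s ^+ M * X i) by apply/funext => i.
  have cE : cost (gap_pow M x') Y r = cost X Y r * s ^+ M.
    by rewrite XE' costZ mulrC.
  have pE q' i j : swap_cost (gap_pow M x') Y q' i j = swap_cost X Y q' i j * s ^+ M.
    by rewrite XE' swap_costZ mulrC.
  have UE i j : expR (L (tperm i j * r)%g s) = expR (L r s) *
      expR (- swap_cost (gap_pow M x') Y r i j).
    rewrite -expRD; congr expR; rewrite /L cost_tperm pE; ring.
  rewrite (eq_bigr (fun i => \sum_j - (expR (L r s) *
      (fun z => 1 - expR (- z)) (swap_cost (gap_pow M x') Y r i j)))); last first.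
    move=> i _; apply: eq_bigr => j _; rewrite UE; ring.
  under eq_bigr do rewrite sumrN -mulr_sumr.
  rewrite sumrN -mulr_sumr.
  have := @sub_inequality k M x' y r k0 xd' yd M0 hM.
  set S1 := \sum_i \sum_j _; set S2 := \sum_i \sum_j _; set e := gap_error x' y => H.
  have sM : s * s ^+ M.-1 = s ^+ M by rewrite -exprS prednK.
  have -> : s * (dL r s * expR (L r s)) =
      - (M%:R * cost (gap_pow M x') Y r + k / 2 * S2 + N * e) * expR (L r s).
    rewrite mulrA; congr (_ * _); rewrite /dL !mulrBr mulrN !opprD.
    congr (_ - _ - _).
    - by rewrite cE -sM; congr (- _); ring.
    - rewrite mulrCA; congr (_ * _); rewrite mulrCA mulr_sumr.
      rewrite mulr_sumr; apply: eq_bigr => i _.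
      rewrite !mulr_sumr; apply: eq_bigr => j _; rewrite pE -sM.
      have nz : 1 + swap_cost X Y 1%g i j * (s * s ^+ M.-1) != 0.
        by rewrite sM; apply: lt0r_neq0; rewrite ltr_pwDl// mulr_ge0// exprn_ge0// ltW.
      by field; rewrite nz lt0r_neq0.
    - rewrite mulrCA; congr (_ * _); rewrite /e gap_errorE big_mkord mulr_sumr.
      apply: eq_bigr => l _; rewrite big_mkord mulr_sumr; apply: eq_bigr => m _.
      by rewrite -/(g l m) expr1 expr0 !mulr1 (mulrC (g l m) s); ring.
  have cxE : s * cost x y r = cost x' y r by rewrite costZ.
  rewrite cxE.
  have -> : - cost x' y r * expR (L r s) + k / 2 * - (expR (L r s) * S1) =
      - (cost x' y r + k / 2 * S1) * expR (L r s) by ring.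
  by apply: ler_wpM2r; [exact: ltW|rewrite lerN2].
split; first by move=> q; apply: le_trans (UG q); exact: expR_ge0.
apply: le_trans (UG 1%g); rewrite -expRD ler_expR /L cost1 mul0r oppr0 sub0r expr1n expr1.
have E1 : \sum_l \sum_m 4 * bounded_log (g l m * 1) <= 4 * n2 ^+ 2.
  apply: (@le_trans _ _ (\sum_(l < n) \sum_(m < n) 4)).
    apply: ler_sum => l _; apply: ler_sum => m _.
    have := @bounded_log_itv (g l m * 1); rewrite mulr1 => /(_ (gg0 l m)); lra.
  by rewrite !sumr_const card_ord -mulrnA -[leLHS]mulr_natr natrM expr2.
have E2 : M%:R^-1 * \sum_i \sum_j (ln (1 + swap_cost X Y 1%g i j * 1) +
    2 * bounded_log (swap_cost X Y 1%g i j * 1)) <=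
    log_weight x y + N ^+ 2 * (ln (1 + n2 ^+ 2) + 2).
  rewrite -sum2_cst -big_split/= mulr_sumr; apply: ler_sum => i _.
  rewrite -big_split/= mulr_sumr; apply: ler_sum => j _.
  rewrite !mulr1.
  have q0 : 0 <= swap_cost x y 1%g i j by exact: swap_cost1_ge0.
  have Z0 := p0 i j.
  (* Consequently [ln (1 + Z) / M] exceeds [ln (1 + q)] by a bounded amount only. *)
  have Zle : swap_cost X Y 1%g i j <= n2 ^+ 2 * swap_cost x y 1%g i j ^+ M.
    wlog ij : i j q0 Z0 / (i <= j)%N => [W|].
      have /orP[ij|ji] := leq_total i j; first exact: W.
      by rewrite swap_costC [in leRHS]swap_costC; apply: W => //; rewrite swap_costC.
    rewrite /swap_cost !perm1 exprMn expr2 mulrACA; apply: ler_pM.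
    - by rewrite subr_ge0; exact: Yd.
    - by rewrite subr_ge0; exact: Xd.
    - exact: gap_powB_le.
    - exact: gap_powB_le.
  set q := swap_cost x y 1%g i j in q0 Zle *; set Z := swap_cost X Y 1%g i j in Z0 Zle *.
  have n20 : 0 <= n2 ^+ 2 by exact: sqr_ge0.
  have l1 : ln (1 + Z) <= ln (1 + n2 ^+ 2) + M%:R * ln (1 + q).
    have q1 : 0 < 1 + q by rewrite ltr_pwDl.
    have n21 : 0 < 1 + n2 ^+ 2 by rewrite ltr_pwDl.
    have qM : 0 < (1 + q) ^+ M by rewrite exprn_gt0.
    rewrite mulr_natl -lnXn// -lnM// ler_ln ?posrE ?mulr_gt0// ?ltr_pwDl//.
    have a1 : 1 <= (1 + q) ^+ M by rewrite exprn_ege1// lerDl.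
    have a2 : q ^+ M <= (1 + q) ^+ M by rewrite lerXn2r ?nnegrE ?addr_ge0// lerDr.
    by nra.
  have l0 : 0 <= ln (1 + n2 ^+ 2) by rewrite ln_ge0// lerDl.
  have /andP[b0 b1] := bounded_log_itv Z0.
  rewrite [leLHS]mulrC ler_pdivrMr//.
  have M1 : 1 <= M%:R :> R by rewrite ler1n.
  by nra.
have N0 : 0 <= N by [].
have := ler_wpM2l k2 E2; have := ler_wpM2l N0 E1; lra.
Qed.

End RadialLower.

(** * The Dunkl kernel along rays *)

Section Dot.
Context {R : realType} {d : nat}.
Implicit Types (x y z a : 'rV[R]_d) (s : R).

Lemma dotC x y : dot x y = dot y x.
Proof. by apply: eq_bigr => i _; rewrite mulrC. Qed.

Lemma dotDl x y z : dot (x + y) z = dot x z + dot y z.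
Proof. by rewrite -big_split; apply: eq_bigr => i _; rewrite mxE mulrDl. Qed.

Lemma dotZl s x y : dot (s *: x) y = s * dot x y.
Proof. by rewrite mulr_sumr; apply: eq_bigr => i _; rewrite mxE mulrA. Qed.

Lemma dotDr x y z : dot x (y + z) = dot x y + dot x z.
Proof. by rewrite dotC dotDl !(dotC x). Qed.

Lemma dotZr s x y : dot x (s *: y) = s * dot x y.
Proof. by rewrite dotC dotZl (dotC x). Qed.

Lemma dotNl x y : dot (- x) y = - dot x y.
Proof. by rewrite -scaleN1r dotZl mulN1r. Qed.

Lemma dotNr x y : dot x (- y) = - dot x y.
Proof. by rewrite dotC dotNl dotC. Qed.

Lemma dotBl x y z : dot (x - y) z = dot x z - dot y z.
Proof. by rewrite dotDl dotNl. Qed.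

Lemma dotBr x y z : dot x (y - z) = dot x y - dot x z.
Proof. by rewrite dotDr dotNr. Qed.

Lemma dot0l y : dot (0 : 'rV[R]_d) y = 0.
Proof. by rewrite -(scale0r (0 : 'rV[R]_d)) dotZl mul0r. Qed.

Lemma dot_suml (I : Type) (r : seq I) (P : pred I) (F : I -> 'rV[R]_d) y :
  dot (\sum_(i <- r | P i) F i) y = \sum_(i <- r | P i) dot (F i) y.
Proof. by elim/big_rec2: _ => [|i u v _ <-]; rewrite ?dot0l ?dotDl. Qed.

Lemma dot_sumr (I : Type) (r : seq I) (P : pred I) (F : I -> 'rV[R]_d) x :
  dot x (\sum_(i <- r | P i) F i) = \sum_(i <- r | P i) dot x (F i).
Proof. by rewrite dotC dot_suml; apply: eq_bigr => i _; rewrite dotC. Qed.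

Lemma dot_ge0 x : 0 <= dot x x.
Proof. by apply: sumr_ge0 => i _; rewrite -expr2 sqr_ge0. Qed.

Lemma dot_eq0 x : (dot x x == 0) = (x == 0).
Proof.
apply/idP/idP => [|/eqP->]; last by rewrite dot0l.
rewrite psumr_eq0; last by move=> i _; rewrite -expr2 sqr_ge0.
move=> /allP H; apply/eqP/rowP => i; rewrite mxE; apply/eqP.
by have := H i (mem_index_enum i); rewrite /= mulf_eq0 orbb.
Qed.

Lemma enorm_sqr x : enorm x ^+ 2 = dot x x.
Proof. by rewrite sqr_sqrtr// dot_ge0. Qed.

Lemma enorm_ge0 x : 0 <= enorm x.
Proof. exact: sqrtr_ge0. Qed.

Lemma enormZ s x : enorm (s *: x) = `|s| * enorm x.
Proof.
by rewrite /enorm dotZl dotZr mulrA -expr2 sqrtrM ?sqr_ge0// sqrtr_sqr.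
Qed.

End Dot.

(** The bound is [t0 ^+ e] times a factor free of [e], so it can be summed against power series
    coefficients. Writing [0 ^+ e] includes the constant monomial. *)
Lemma difference_quotient_pow (R : realFieldType) (e : nat) (t t' t0 : R) :
  0 < t0 -> t != 0 -> t' != 0 -> `|t| <= t0 -> `|t'| <= t0 ->
  `|(t ^+ e - 0 ^+ e) / t - (t' ^+ e - 0 ^+ e) / t'| <=
  t0 ^+ e * ((`|t| + `|t'|) / t0 ^+ 2).
Proof.
move=> t00 tN0 tN0' tt0 tt0'.
have rhs0 k : 0 <= t0 ^+ k * ((`|t| + `|t'|) / t0 ^+ 2).
  by rewrite !mulr_ge0 ?exprn_ge0 ?addr_ge0 ?invr_ge0 ?exprn_ge0// ltW.
case: e (rhs0 e) => [|[|e]] rhs.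
- by rewrite -[t ^+ 0]/(0 ^+ 0) -[t' ^+ 0]/(0 ^+ 0) !subrr !mul0r subrr normr0.
- by rewrite expr0n !expr1 !subr0 !divff// subrr normr0.
rewrite !expr0n/= !subr0 [t ^+ e.+2]exprSr mulfK// [t' ^+ e.+2]exprSr mulfK//.
apply: le_trans (ler_normB _ _) _; rewrite !normrX.
have -> : t0 ^+ e.+2 * ((`|t| + `|t'|) / t0 ^+ 2) = t0 ^+ e * `|t| + t0 ^+ e * `|t'|.
  rewrite -mulrDr !exprSr expr0; field.
  by rewrite lt0r_neq0.
rewrite !exprSr; apply: lerD; apply: ler_wpM2r => //;
  by apply: lerXn2r; rewrite // nnegrE ltW.
Qed.

(* The difference quotients of the partial sums along a line are uniformly Cauchy,
   because [(t ^+ e - 0 ^+ e) / t] is constant for [e <= 1] and [O(t)] for [e >= 2]. *)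
Lemma real_analytic_derivable (R : realType) (d : nat) (f : 'rV[R]_d -> R) x v :
  real_analytic f -> derivable f x v.
Proof.
move=> /(_ x)[c [r [r0 fP]]].
pose t0 := r / (enorm v + 1).
have v1 : 0 < enorm v + 1 by rewrite ltr_wpDl// enorm_ge0.
have t00 : 0 < t0 by rewrite divr_gt0.
have small t : `|t| <= t0 -> enorm (t *: v) < r.
  move=> tt0; rewrite enormZ; apply: (@le_lt_trans _ _ (t0 * enorm v)).
    by rewrite ler_wpM2r// enorm_ge0.
  by rewrite /t0 mulrAC ltr_pdivrMr// ltr_pM2l// ltrDl.
pose C N (m : {ffun 'I_d -> 'I_N}) : R := c (fun i => m i : nat) * \prod_i v 0 i ^+ m i.
pose D N (m : {ffun 'I_d -> 'I_N}) : nat := (\sum_i m i)%N.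
have termE N (m : {ffun 'I_d -> 'I_N}) (t : R) :
    c (fun i => m i : nat) * \prod_(i < d) (t *: v) 0 i ^+ m i = C N m * t ^+ D N m.
  rewrite /C -mulrA; congr (_ * _).
  rewrite (eq_bigr (fun i => t ^+ m i * v 0 i ^+ m i)); last first.
    by move=> i _; rewrite mxE exprMn.
  by rewrite big_split/= mulrC prodrXr.
clearbody C D.
pose S N (t : R) := \sum_(m : {ffun 'I_d -> 'I_N}) C N m * t ^+ D N m.
have SP t : `|t| <= t0 -> S N t @[N --> \oo] --> f (x + t *: v).
  move=> /small /fP [_]; apply: cvg_trans; apply: near_eq_cvg.
  by apply: nearW => N; apply: eq_bigr => m _; rewrite termE.
(* Absolute convergence at [t0 *: v] bounds all absolute partial sums there, uniformly in [N]. *)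
have [B [B0 HB]] : exists B : R, 0 <= B /\ forall N,
    \sum_(m : {ffun 'I_d -> 'I_N}) `|C N m| * t0 ^+ D N m <= B.
  have tt : `|t0| <= t0 by rewrite gtr0_norm.
  have [/cvg_seq_bounded + _] := fP (t0 *: v) (small t0 tt).
  move=> [M [_ /(_ (`|M| + 1))]]; rewrite (le_lt_trans (ler_norm M)) ?ltrDl// => /(_ isT) HM.
  exists (`|M| + 1); split => [|N]; first by rewrite addr_ge0.
  apply: le_trans (HM N I); apply: le_trans (ler_norm _).
  apply: ler_sum => m _; by rewrite termE [leRHS]normrM normrX (gtr0_norm t00).
pose q (t : R) : R := (f (x + t *: v) - f x) / t.
have qP t t' : t != 0 -> t' != 0 -> `|t| <= t0 -> `|t'| <= t0 ->
    `|q t - q t'| <= B * ((`|t| + `|t'|) / t0 ^+ 2).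
  move=> tN0 tN0' tt0 tt0'.
  have S0 : S N 0 @[N --> \oo] --> f x.
    by have := @SP 0; rewrite normr0 scale0r addr0; apply; exact: ltW.
  pose Q N := `|(S N t - S N 0) / t - (S N t' - S N 0) / t'|.
  have Qq : Q N @[N --> \oo] --> `|q t - q t'|.
    apply: cvg_norm; apply: cvgB.
      by apply: cvgMl; apply: cvgB => //; exact: SP.
    by apply: cvgMl; apply: cvgB => //; exact: SP.
  rewrite -(cvg_lim _ Qq)//; apply: limr_le; first by apply/cvg_ex; eexists; exact: Qq.
  apply: nearW => N; rewrite /Q /S -!sumrB !mulr_suml -sumrB.
  apply: le_trans (ler_norm_sum _ _ _) _.
  apply: (@le_trans _ _ (\sum_(m : {ffun 'I_d -> 'I_N})
    (`|C N m| * t0 ^+ D N m) * ((`|t| + `|t'|) / t0 ^+ 2))).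
    apply: ler_sum => m _; rewrite -!mulrBr -!mulrA -mulrBr [leLHS]normrM ler_wpM2l//.
    exact: difference_quotient_pow.
  rewrite -mulr_suml ler_wpM2r// ?mulr_ge0 ?addr_ge0 ?invr_ge0 ?exprn_ge0//.
  exact: ltW.
rewrite /derivable; apply: cauchy_cvg; apply: cauchy_exP => e e0.
(* [dl] is chosen so that [B * (dl + |t|) / t0 ^+ 2 < e] whenever [|t| < dl]; [q dl] then is the
   centre of a ball of radius [e] containing these [q t]. *)
pose K := B / t0 ^+ 2 + 1.
have K0 : 0 < K by rewrite ltr_wpDl// divr_ge0// exprn_ge0// ltW.
pose dl := Num.min t0 (e / 2 / K).
have dl0 : 0 < dl by rewrite lt_min t00 !divr_gt0.
exists (q dl); exists dl => //= t /=; rewrite sub0r normrN => tdl tN0.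
rewrite /ball/=.
have -> : t^-1 *: (f (t *: v + x) - f x) = q t.
  by rewrite /q [LHS]mulrC [x + _]addrC.
have := @qP dl t (lt0r_neq0 dl0) tN0; rewrite (gtr0_norm dl0) => /(_ _ _)/le_lt_trans; apply.
- by rewrite ge_min lexx.
- by apply: le_trans (ltW tdl) _; rewrite ge_min lexx.
have dlK : dl * K <= e / 2 by rewrite -ler_pdivlMr// ge_min lexx orbT.
have : (dl + `|t|) * K < e.
  have : `|t| * K < dl * K by rewrite ltr_pM2r.
  by rewrite mulrDl; lra.
apply: le_lt_trans.
have -> : (dl + `|t|) * K = B / t0 ^+ 2 * (dl + `|t|) + (dl + `|t|) by rewrite /K; ring.
have -> : B * ((dl + `|t|) / t0 ^+ 2) = B / t0 ^+ 2 * (dl + `|t|) by ring.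
by rewrite lerDl addr_ge0// ltW.
Qed.

(** Polarisation from three norm identities, since [phi] is isometric on a hyperplane only. *)
Lemma enorm_dot (R : realType) (d d' : nat) (phi : {linear 'rV[R]_d -> 'rV[R]_d'})
    (u v : 'rV[R]_d) :
  enorm (phi u) = enorm u -> enorm (phi v) = enorm v ->
  enorm (phi (u + v)) = enorm (u + v) -> dot (phi u) (phi v) = dot u v.
Proof.
move=> hu hv; move/(congr1 (fun t => t ^+ 2)).
move: (congr1 (fun t => t ^+ 2) hu) (congr1 (fun t => t ^+ 2) hv).
rewrite !enorm_sqr linearD !dotDl !dotDr (dotC v u) (dotC (phi v) (phi u)).
by lra.
Qed.

(* The images [g i] of [e_i - (e_0 + ... + e_n) / (n + 1)]; the roots are the
   differences [g i - g j]. *)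
Definition simplex_frame {R : realType} {n d : nat} (g : 'I_n.+1 -> 'rV[R]_d) : Prop :=
  (forall i j, dot (g i) (g j) = (i == j)%:R - n.+1%:R^-1) /\ \sum_i g i = 0.

(** Subtracting the mean [m] moves [e i] into the hyperplane where [phi] is isometric and leaves the
    differences [e i - e j] unchanged. *)
Lemma root_system_A_frame (R : realType) (n d : nat) (Sigma Pos : {fset 'rV[R]_d}) :
  root_system_A n Sigma Pos ->
  exists g : 'I_n.+1 -> 'rV[R]_d, [/\ simplex_frame g,
    forall a, a \in Sigma <-> exists i j, i != j /\ a = g i - g j &
    forall a, a \in Pos <-> exists i j : 'I_n.+1, (i < j)%N /\ a = g i - g j].
Proof.
move=> [phi [phiN _ SigmaP PosP]].
pose e (i : 'I_n.+1) : 'rV[R]_n.+1 := delta_mx 0 i.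
pose m : 'rV[R]_n.+1 := n.+1%:R^-1 *: \sum_i e i.
have N0 : n.+1%:R != 0 :> R by rewrite pnatr_eq0.
have eE i l : e i 0 l = (i == l)%:R by rewrite mxE eqxx/= eq_sym.
have mE l : m 0 l = n.+1%:R^-1.
  rewrite mxE summxE (bigD1 l)// eE eqxx big1 /= ?addr0 ?mulr1// => i il.
  by rewrite mxE eqxx/= eq_sym (negbTE il).
pose u i := e i - m.
have uE i l : u i 0 l = (i == l)%:R - n.+1%:R^-1 by rewrite mxE eE mxE mE.
have sum_delta i : \sum_(l < n.+1) ((i == l)%:R : R) = 1.
  by rewrite (bigD1 i)//= eqxx big1 ?addr0// => l; rewrite eq_sym => /negbTE->.
have Hu i : \sum_l u i 0 l = 0.
  under eq_bigr do rewrite uE.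
  by rewrite sumrB sum_delta sumr_const card_ord -[X in _ - X]mulr_natr mulVf// subrr.
have gE i j : phi (e i - e j) = phi (u i) - phi (u j).
  by rewrite -linearB; congr (phi _); rewrite /u opprB addrA subrK.
exists (fun i => phi (u i)); split; [split| |].
- move=> i j; rewrite enorm_dot.
  + rewrite /dot (eq_bigr (fun l => (i == l)%:R * (j == l)%:R -
      n.+1%:R^-1 * (i == l)%:R - u j 0 l * n.+1%:R^-1)); last first.
      by move=> l _; rewrite !uE; ring.
    rewrite !sumrB -mulr_suml -mulr_sumr Hu sum_delta mul0r subr0 mulr1; congr (_ - _).
    rewrite (bigD1 i)//= eqxx mul1r big1 ?addr0 1?eq_sym// => l.
    by rewrite eq_sym => /negbTE->; rewrite mul0r.
  + exact: phiN (Hu i).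
  + exact: phiN (Hu j).
  + apply: phiN => /=; under eq_bigr do rewrite mxE.
    by rewrite big_split/= !Hu addr0.
- rewrite -linear_sum (_ : \sum_i u i = 0) ?linear0//.
  apply/rowP => l; rewrite summxE mxE; under eq_bigr do rewrite uE.
  rewrite sumrB sumr_const card_ord -[X in _ - X]mulr_natr mulVf//.
  by under eq_bigr do rewrite eq_sym; rewrite sum_delta subrr.
- by move=> a; rewrite SigmaP; split => -[i [j [ij ->]]]; exists i, j; split => //.
- by move=> a; rewrite PosP; split => -[i [j [ij ->]]]; exists i, j; split => //.
Qed.

(** * Permutations acting through the frame *)

Section Frame.
Context {R : realType} {n d : nat}.
Implicit Types (g : 'I_n.+1 -> 'rV[R]_d) (X Y : 'rV[R]_d) (p : 'S_n.+1).

Definition frame_coord g X (i : 'I_n.+1) : R := dot (g i) X.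

(** For a simplex frame this permutes the frame coordinates; vectors orthogonal to the frame are
    fixed. *)
Definition perm_act g p X : 'rV[R]_d :=
  X + \sum_i (frame_coord g X (p i) - frame_coord g X i) *: g i.

Lemma frame_coordZ g (s : R) X i : frame_coord g (s *: X) i = s * frame_coord g X i.
Proof. exact: dotZr. Qed.

(** Permuting does not change the sum of the coordinates, so the constant [n.+1%:R^-1] in the inner
    products drops out. *)
Lemma frame_coord_act g p X i : simplex_frame g ->
  frame_coord g (perm_act g p X) i = frame_coord g X (p i).
Proof.
move=> gf; rewrite /frame_coord dotDr dot_sumr.
rewrite (eq_bigr (fun j => (i == j)%:R * (frame_coord g X (p j) - frame_coord g X j) -
    n.+1%:R^-1 * (frame_coord g X (p j) - frame_coord g X j))); last first.
  by move=> j _; rewrite dotZr gf.1; ring.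
rewrite sumrB -[X in _ - X]mulr_sumr sumrB.
rewrite -(reindex_inj (@perm_inj _ p) (P := xpredT) (F := frame_coord g X)).
rewrite subrr mulr0 subr0 (bigD1 i)//= eqxx mul1r big1 ?addr0.
  by rewrite addrC subrK.
by move=> j; rewrite eq_sym => /negbTE->; rewrite mul0r.
Qed.

Lemma perm_act_comp g p q X : simplex_frame g ->
  perm_act g q (perm_act g p X) = perm_act g (q * p)%g X.
Proof.
move=> gf; rewrite {1}/perm_act [in LHS]/perm_act -addrA -big_split/=.
congr (_ + _); apply: eq_bigr => i _; rewrite !frame_coord_act// -scalerDl permM.
by congr (_ *: _); ring.
Qed.

Lemma perm_act1 g X : perm_act g 1%g X = X.
Proof. by rewrite /perm_act big1 ?addr0// => i _; rewrite perm1 subrr scale0r. Qed.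

Lemma perm_actZ g p (s : R) X : perm_act g p (s *: X) = s *: perm_act g p X.
Proof.
rewrite /perm_act scalerDr scaler_sumr; congr (_ + _); apply: eq_bigr => i _.
by rewrite !frame_coordZ scalerA mulrBr.
Qed.

Lemma dot_perm_act g p X Y :
  dot (perm_act g p X) Y = dot X Y - cost (frame_coord g X) (frame_coord g Y) p.
Proof.
rewrite /perm_act dotDl dot_suml /cost -sumrN; congr (_ + _).
by apply: eq_bigr => i _; rewrite dotZl /frame_coord; ring.
Qed.

Lemma dot_root g i j X : dot (g i - g j) X = frame_coord g X i - frame_coord g X j.
Proof. exact: dotBl. Qed.

Lemma dot_root_root g i j : simplex_frame g -> i != j ->
  dot (g i - g j) (g i - g j) = 2.
Proof.
move=> gf ij; rewrite dotBl !dotBr !gf.1 !eqxx (eq_sym j) (negbTE ij)/=; ring.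
Qed.

Lemma reflection_root g i j X : simplex_frame g -> i != j ->
  reflection (g i - g j) X = perm_act g (tperm i j) X.
Proof.
move=> gf ij; rewrite /reflection dot_root_root// /perm_act; congr (_ + _).
rewrite (bigD1 i)//= (bigD1 j) ?(eq_sym j)//= tpermL tpermR big1 ?addr0.
  by rewrite dot_root mulrAC divff// mul1r -scaleNr opprB scalerBr -scaleNr opprB.
by move=> l /andP[li lj]; rewrite tpermD 1?eq_sym// subrr scale0r.
Qed.

(** Permutation actions form a transformation group containing the reflections, so minimality of the
    generated group applies. *)
Lemma weyl_group_sub g (Sigma : {fset 'rV[R]_d}) w : simplex_frame g ->
  (forall a, a \in Sigma <-> exists i j, i != j /\ a = g i - g j) ->
  weyl_group Sigma w -> exists p, w = perm_act g p.
Proof.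
move=> gf SP Ww; apply: (Ww [set w | exists p, w = perm_act g p]); split; last first.
  move=> _ [a /= /SP[i [j [ij ->]]] <-]; exists (tperm i j).
  by apply/funext => X; exact: reflection_root.
split.
- by exists 1%g; apply/funext => X; rewrite perm_act1.
- move=> _ _ [p ->] [q ->]; exists (p * q)%g; apply/funext => X /=.
  exact: perm_act_comp.
- move=> _ h [p ->] hK _; exists (p^-1)%g; apply/funext => X.
  by rewrite -[X in h X](perm_act1 g) -(mulgV p) -perm_act_comp.
Qed.

(** Each positive root is [g i - g j] for exactly one pair [i < j]; since [h] is even and [h 0 = 0],
    the double sum counts it twice and the diagonal vanishes. *)
Lemma sum_pos_roots g (Pos : {fset 'rV[R]_d}) (h : 'rV[R]_d -> R) : simplex_frame g ->
  (forall a, a \in Pos <-> exists i j : 'I_n.+1, (i < j)%N /\ a = g i - g j) ->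
  h 0 = 0 -> (forall a, h (- a) = h a) ->
  \sum_(a <- Pos) h a = (\sum_i \sum_j h (g i - g j)) / 2.
Proof.
move=> gf PosP h0 hN.
have -> : \sum_(a <- Pos) h a =
    \sum_(ij : 'I_n.+1 * 'I_n.+1 | (ij.1 < ij.2)%N) h (g ij.1 - g ij.2).
  pose s := [seq g ij.1 - g ij.2 | ij <- enum [pred ij : 'I_n.+1 * 'I_n.+1 | (ij.1 < ij.2)%N]].
  suff ps : perm_eq Pos s by rewrite (perm_big s ps) big_map big_enum.
  apply: uniq_perm; first exact: fset_uniq.
    rewrite map_inj_in_uniq ?enum_uniq// => -[i j] [i' j'].
    rewrite !mem_enum !inE/= => ij ij' E.
    (* Pairing with [g l] recovers the indicator of [i] minus that of [j], which determines both
       indices. *)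
    have C l : (l == i)%:R - (l == j)%:R = (l == i')%:R - (l == j')%:R :> R.
      have := congr1 (fun a => dot (g l) a) E; rewrite /= !dotBr !gf.1.
      by move: (_ == i)%:R (_ == j)%:R (_ == i')%:R (_ == j')%:R n.+1%:R^-1 => a1 a2 a3 a4 e H; lra.
    have ii : i = i'.
      apply/eqP; have := C i; rewrite eqxx -[i == j]val_eqE (ltn_eqF ij)/=.
      by case: (i == i') => //; case: (i == j') => /=; lra.
    have jj : j = j'.
      apply/eqP; have := C j; rewrite eqxx -[j == i]val_eqE (gtn_eqF ij)/=.
      by case: (j == j') => //; case: (j == i') => /=; lra.
    by rewrite ii jj.
  move=> a; apply/idP/mapP => [/PosP[i [j [ij ->]]]|[[i j] + ->]].
    by exists (i, j) => //; rewrite mem_enum inE.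
  by rewrite mem_enum inE /= => ij; apply/PosP; exists i, j.
rewrite pair_bigA/=.
rewrite [X in _ = X / 2](bigID (fun ij : 'I_n.+1 * 'I_n.+1 => (ij.1 < ij.2)%N))/=.
rewrite [X in _ = (_ + X) / 2](bigID (fun ij : 'I_n.+1 * 'I_n.+1 => (ij.2 < ij.1)%N))/=.
rewrite [X in _ = (_ + (_ + X)) / 2]big1 ?addr0; last first.
  by move=> [i j] /=; case: (ltngtP i j) => // /val_inj-> _; rewrite subrr.
have -> : \sum_(ij : 'I_n.+1 * 'I_n.+1 | ~~ (ij.1 < ij.2)%N && (ij.2 < ij.1)%N)
    h (g ij.1 - g ij.2) =
    \sum_(ij : 'I_n.+1 * 'I_n.+1 | (ij.1 < ij.2)%N) h (g ij.1 - g ij.2).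
  pose sw (ij : 'I_n.+1 * 'I_n.+1) := (ij.2, ij.1).
  have swK : involutive sw by case.
  rewrite (reindex_inj (inv_inj swK))/=; apply: eq_big => [[i j]/=|[i j] _ /=].
    by case: ltngtP.
  by rewrite -hN opprB.
by field.
Qed.

Lemma closure_chamber_dot_ge0 (Pos : {fset 'rV[R]_d}) a X :
  closure (chamber Pos) X -> a \in Pos -> 0 <= dot a X.
Proof.
move=> XC aP; rewrite leNgt; apply/negP => aX.
have cd : continuous (fun X : 'rV[R]_d => dot a X).
  apply: continuous_big => [|i _ Z]; first exact: add_continuous.
  have cZ := @coord_continuous R 1 d 0 i Z.
  exact: (@cvgM R _ (nbhs Z) _ (cst (a 0 i)) (fun X : 'rV[R]_d => X 0 i) _ _ (cvg_cst (a 0 i)) cZ).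
have : nbhs X [set Z | dot a Z < 0].
  by apply: (cd X [set r : R | r < 0]); exact: lt_nbhsl.
move=> /XC[Z [ZC /= Zlt]].
by have := ZC a aP; lra.
Qed.

Lemma nonincr_frame_coord g (Pos : {fset 'rV[R]_d}) X :
  (forall a, a \in Pos <-> exists i j : 'I_n.+1, (i < j)%N /\ a = g i - g j) ->
  (forall a, a \in Pos -> 0 <= dot a X) -> nonincr (frame_coord g X).
Proof.
move=> PosP XC i j; rewrite leq_eqVlt => /orP[/eqP/val_inj->//|ij].
rewrite -subr_ge0 -dot_root; apply: XC.
by apply/PosP; exists i, j.
Qed.

End Frame.

(** * The radial system of the Dunkl kernel and bounds for the spherical function *)

Lemma is_derive_radial (R : realType) (d : nat) (f : 'rV[R]_d -> R) (s : R) Z :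
  derivable f (s *: Z) Z ->
  is_derive s 1 (fun t : R => f (t *: Z)) ('D_Z f (s *: Z)).
Proof.
have E : (fun h : R =>
      h^-1 *: (((fun t : R => f (t *: Z)) \o shift s) (h *: (1 : R)) - f (s *: Z))) =
    (fun h : R => h^-1 *: ((f \o shift (s *: Z)) (h *: Z) - f (s *: Z))).
  apply/funext => h /=; congr (_ *: (f _ - _)).
  by rewrite [h *: 1]mulr1 scalerDl.
move=> df; split; first by rewrite /derivable E.
by rewrite /derive E.
Qed.

Lemma reflectionN (R : realType) (d : nat) (a X : 'rV[R]_d) :
  reflection (- a) X = reflection a X.
Proof.
rewrite /reflection dotNl dotNr dotNl opprK scalerN -scaleNr mulrN mulNr opprK.
by [].
Qed.

(** The Dunkl equation is taken at [s Z] in the direction [Z = p X]. There [s <a, Z> / <a, s Z> = 1]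
    leaves plain differences under reflections, which act on [p] by transpositions. The exponential
    factor turns [<p X, Y>] into [- c_p]. *)
Lemma dunkl_radial_system (R : realType) (n d : nat) (Pos : {fset 'rV[R]_d}) (k : R)
    (g : 'I_n.+1 -> 'rV[R]_d) E X Y : simplex_frame g ->
  (forall a, a \in Pos <-> exists i j : 'I_n.+1, (i < j)%N /\ a = g i - g j) ->
  is_dunkl_kernel Pos k E ->
  let G (p : 'S_n.+1) (s : R) := expR (- (s * dot X Y)) * E (s *: perm_act g p X) Y in
  exists dG, radial_system k (frame_coord g X) (frame_coord g Y) G dG.
Proof.
move=> gf PosP hE G; have [Ean Eeq E0] := hE Y.
pose f := E ^~ Y; pose Z p := perm_act g p X.
pose dG p s := - dot X Y * G p s + expR (- (s * dot X Y)) * 'D_(Z p) f (s *: Z p).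
have dGP p (s : R) : is_derive s 1 (G p) (dG p s).
  have d1 : is_derive s 1 (fun s : R => expR (- (s * dot X Y)))
      (- dot X Y * expR (- (s * dot X Y))).
    apply: is_derive_expRf; apply: is_derive_oppf.
    have H := is_derive_mulf (is_derive_id s 1) (is_derive_cst (dot X Y) s (1 : R)).
    by apply: (is_derive_eq H); rewrite mul1r mulr0 addr0.
  have d2 : is_derive s 1 (fun s : R => E (s *: Z p) Y) ('D_(Z p) f (s *: Z p)).
    by apply: (@is_derive_radial R d f); exact: real_analytic_derivable.
  have H := is_derive_mulf d1 d2.
  by apply: (is_derive_eq H); rewrite /dG /G mulrA.
exists dG; split.
- move=> p; apply: continuous_subspaceT => s; exact: is_derive_continuous (dGP p s).
- by move=> p; rewrite /G mul0r oppr0 expR0 mul1r scale0r E0.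
- by move=> p s _; exact: dGP.
move=> p s /andP[s0 _].
have := Eeq (Z p) (s *: Z p); rewrite /dunkl_operator -/f -[E (s *: Z p) Y]/(f (s *: Z p)) => Es.
have {}Es : s * 'D_(Z p) f (s *: Z p) = s * dot (Z p) Y * f (s *: Z p) -
    k * \sum_(a <- Pos) (f (s *: Z p) - f (reflection a (s *: Z p))).
  rewrite -mulrA -Es mulrDr [k * _]mulr_sumr.
  suff -> : s * \sum_(a <- Pos) k * dot a (Z p) * difference_quotient f a (s *: Z p) =
      \sum_(a <- Pos) k * (f (s *: Z p) - f (reflection a (s *: Z p))) by rewrite addrK.
  rewrite mulr_sumr; apply: eq_bigr => a _.
  rewrite /difference_quotient dotZr mulf_eq0 (gt_eqF s0)/=.
  (* On the hyperplane the coefficient [dot a (Z p)] vanishes and the reflection fixes the point, so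
     both sides are 0. *)
  have [aZ|aZ] := eqVneq (dot a (Z p)) 0.
    rewrite aZ mulr0 !mul0r mulr0 /reflection dotZr aZ !mulr0 mul0r scale0r subr0.
    by rewrite subrr mulr0.
  by field; rewrite aZ gt_eqF.
rewrite (sum_pos_roots (h := fun a => f (s *: Z p) - f (reflection a (s *: Z p))) gf PosP) in Es;
  last 2 first.
- by rewrite /reflection scaler0 subr0 subrr.
- by move=> a; rewrite reflectionN.
have -> : \sum_i \sum_j (G (tperm i j * p)%g s - G p s) = - (expR (- (s * dot X Y)) *
    \sum_i \sum_j (f (s *: Z p) - f (reflection (g i - g j) (s *: Z p)))).
  rewrite mulr_sumr -sumrN; apply: eq_bigr => i _.
  rewrite mulr_sumr -sumrN; apply: eq_bigr => j _.
  have -> : reflection (g i - g j) (s *: Z p) = s *: perm_act g (tperm i j * p)%g X.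
    have [<-|ij] := eqVneq i j.
      by rewrite tperm1 mul1g subrr /reflection scaler0 subr0.
    by rewrite reflection_root// perm_actZ perm_act_comp.
  by rewrite /G /f /Z; ring.
rewrite /dG mulrDr [s * (expR _ * _)]mulrCA Es dot_perm_act /G -/(Z p) -/(f _).
by field.
Qed.

Lemma weyl_group_id (R : realType) (d : nat) (Sigma : {fset 'rV[R]_d}) :
  weyl_group Sigma id.
Proof. by move=> M [[]]. Qed.

Lemma log_weight_frame (R : realType) (n d : nat) (Pos : {fset 'rV[R]_d})
    (g : 'I_n.+1 -> 'rV[R]_d) X Y : simplex_frame g ->
  (forall a, a \in Pos <-> exists i j : 'I_n.+1, (i < j)%N /\ a = g i - g j) ->
  \sum_(a <- Pos) ln (1 + dot a X * dot a Y) =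
  log_weight (frame_coord g X) (frame_coord g Y) / 2.
Proof.
move=> gf PosP.
rewrite (sum_pos_roots (h := fun a => ln (1 + dot a X * dot a Y)) gf PosP).
- congr (_ / 2); apply: eq_bigr => i _; apply: eq_bigr => j _.
  by rewrite !dot_root /swap_cost !perm1 mulrC.
- by rewrite !dot0l mul0r addr0 ln1.
- by move=> a; rewrite !dotNl mulrNN.
Qed.

(** Above, every group element is a permutation action and obeys the same bound. Below, the other
    terms are nonnegative and the identity term alone suffices, which costs the order of the
    group. *)
Lemma spherical_bounds (R : realType) (n d : nat) (Sigma Pos : {fset 'rV[R]_d})
    (k : R) (E : 'rV[R]_d -> 'rV[R]_d -> R) :
  root_system_A n Sigma Pos -> 0 < k -> is_dunkl_kernel Pos k E ->
  exists C1 C2 : R, [/\ 0 < C1, 0 < C2 & forall X Y,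
    (forall a, a \in Pos -> 0 <= dot a X) -> (forall a, a \in Pos -> 0 <= dot a Y) ->
    let B := expR (dot X Y - k * \sum_(a <- Pos) ln (1 + dot a X * dot a Y)) in
    C1 * B <= spherical Sigma E Y X <= C2 * B].
Proof.
move=> /root_system_A_frame[g [gf SigmaP PosP]] k0 hE.
have [C2 C20 upper] := @radial_system_upper R n k k0.
have [C1 C10 lower] := @radial_system_lower R n k k0.
pose W := weyl_group Sigma.
have Wsub w : W w -> exists p, w = perm_act g p by exact: weyl_group_sub.
have Wfin : finite_set W.
  apply: (@sub_finite_set _ _ [set perm_act g p | p in [set: 'S_n.+1]]).
    by move=> w /Wsub[p ->]; exists p.
  exact/finite_image/finite_finset.
pose N := #|` fset_set W|.
have idW : id \in fset_set W by rewrite in_fset_set// inE; exact: weyl_group_id.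
have N0 : 0 < N%:R :> R.
  by rewrite ltr0n /N cardfs_gt0; apply/fset0Pn; exists id.
exists (C1 / N%:R), C2; split => [||X Y XC YC]; rewrite ?divr_gt0//.
have xd := nonincr_frame_coord PosP XC; have yd := nonincr_frame_coord PosP YC.
have [dG sys] := @dunkl_radial_system R n d Pos k g E X Y gf PosP hE.
set G := (fun p s => _) in sys.
have EG p : E (perm_act g p X) Y = expR (dot X Y) * G p 1.
  by rewrite /G mul1r scale1r mulrA -expRD subrr expR0 mul1r.
have BE : expR (dot X Y - k * \sum_(a <- Pos) ln (1 + dot a X * dot a Y)) =
    expR (dot X Y) * expR (- (k / 2 * log_weight (frame_coord g X) (frame_coord g Y))).
  by rewrite (log_weight_frame X Y gf PosP) -expRD; congr (expR (_ - _)); ring.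
have [G0 Glow] := lower _ _ _ _ xd yd sys.
have Gup := upper _ _ _ _ xd yd sys.
set B := expR (- _) in BE Glow Gup.
rewrite BE /spherical -/W -/N fsbig_finite//=.
have Ege0 w : w \in fset_set W -> 0 <= E (w X) Y.
  rewrite in_fset_set// inE => /Wsub[p ->]; rewrite EG mulr_ge0//; exact: expR_ge0.
apply/andP; split.
  rewrite [leLHS]mulrAC [leLHS]mulrC ler_wpM2l ?invr_ge0 ?(ltW N0)//.
  rewrite mulrCA (bigD1_seq _ idW (fset_uniq _))/=.
  have -> : E X Y = expR (dot X Y) * G 1%g 1 by rewrite -EG perm_act1.
  rewrite -[leLHS]addr0; apply: lerD; first by rewrite ler_wpM2l// expR_ge0.
  by rewrite big_seq_cond; apply: sumr_ge0 => w /andP[+ _]; exact: Ege0.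
rewrite mulrC ler_pdivrMr//.
apply: (@le_trans _ _ (\sum_(w <- fset_set W) C2 * (expR (dot X Y) * B))).
  rewrite big_seq [leRHS]big_seq; apply: ler_sum => w.
  rewrite in_fset_set// inE => /Wsub[p ->].
  by rewrite EG [leRHS]mulrCA ler_wpM2l// expR_ge0.
by rewrite big_const_seq count_predT iter_addr_0 mulr_natr.
Qed.

(** * The normalising constant *)

(** The integral of a nonnegative function is a supremum over the simple functions below it. This
    form compares heat kernels and iterated integrals directly with explicit functions. *)
Lemma ge0_le_integral_nomeas (disp : measure_display) (T : measurableType disp)
    (R : realType) (mu : {measure set T -> \bar R}) (D : set T) (f g : T -> \bar R) :
  (forall x, D x -> (0 <= f x)%E) -> (forall x, D x -> (f x <= g x)%E) ->
  (\int[mu]_(x in D) f x <= \int[mu]_(x in D) g x)%E.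
Proof.
move=> f0 fg; rewrite !ge0_integralE//; last first.
  by move=> x Dx; apply: le_trans (fg x Dx); exact: f0.
apply: ereal_sup_le => _ /= [h hf <-]; exists h => // x.
apply: le_trans (hf x) _; rewrite /patch; case: ifPn => // xD.
by apply: fg; rewrite inE in xD.
Qed.

Section IntegralRn.
Context {R : realType}.

Lemma integral_Rn_ge0 d (f : 'rV[R]_d -> \bar R) :
  (forall x, (0 <= f x)%E) -> (0 <= integral_Rn f)%E.
Proof.
elim: d f => [|d IH] f f0 /=; first exact: f0.
by apply: integral_ge0 => t _; apply: IH => v; exact: f0.
Qed.

Lemma integral_Rn_le d (f g : 'rV[R]_d -> \bar R) :
  (forall x, (0 <= f x)%E) -> (forall x, (f x <= g x)%E) ->
  (integral_Rn f <= integral_Rn g)%E.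
Proof.
elim: d f g => [|d IH] f g f0 fg /=; first exact: fg.
apply: ge0_le_integral_nomeas => t _; first by apply: integral_Rn_ge0 => v; exact: f0.
by apply: IH => v; [exact: f0|exact: fg].
Qed.

(** The constant [c] is general because the induction absorbs the factor of the first coordinate
    into it. *)
Lemma integral_Rn_prod d (h : 'I_d -> R -> R) (K : 'I_d -> R) (c : R) :
  0 <= c -> (forall i t, 0 <= h i t) ->
  (forall i, measurable_fun setT (h i)) ->
  (forall i, \int[lebesgue_measure]_t (h i t)%:E = (K i)%:E)%E ->
  integral_Rn (fun x : 'rV[R]_d => (c * \prod_i h i (x 0 i))%:E) = (c * \prod_i K i)%:E.
Proof.
elim: d h K c => [|d IH] h K c c0 h0 mh hK /=; first by rewrite !big_ord0.
have K0 i : 0 <= K i.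
  by rewrite -lee_fin -hK; apply: integral_ge0 => t _; rewrite lee_fin.
pose Kt := \prod_(i < d) K (lift ord0 i).
have Kt0 : 0 <= Kt by apply: prodr_ge0.
transitivity (\int[lebesgue_measure]_(t in [set: R]) ((c * Kt)%:E * (h ord0 t)%:E))%E.
  apply: eq_integral => t _.
  rewrite -EFinM -[RHS]/(((c * Kt) * h ord0 t)%:E) mulrAC.
  rewrite -(IH (fun i => h (lift ord0 i)) (fun i => K (lift ord0 i)))//; last exact: mulr_ge0.
  congr integral_Rn; apply/funext => v; rewrite big_ord_recl mulrA; congr (c * _ * _)%:E.
    congr (h _ _).
    have := @row_mxEl R 1 1 d t%:M v 0 ord0.
    rewrite (_ : lshift d ord0 = ord0) => [E|]; last exact/val_inj.
    by rewrite [LHS]E mxE.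
  apply: eq_bigr => i _; congr (h _ _).
  have := @row_mxEr R 1 1 d t%:M v 0 i.
  rewrite (_ : rshift 1 i = lift ord0 i) => [E|]; last exact/val_inj.
  by rewrite [LHS]E.
rewrite ge0_integralZl//=.
- by rewrite hK -EFinM big_ord_recl /Kt; congr (_%:E); ring.
- by apply/measurable_EFinP; exact: mh.
- by move=> t _; rewrite lee_fin.
- by rewrite lee_fin mulr_ge0.
Qed.

End IntegralRn.

(** This is [ln u <= u - 1] at [u = (1 + r) / (m / e + 1)], where [m u <= e (1 + r)]. *)
Lemma powR_le_expR (R : realType) (m e r : R) : 0 <= m -> 0 < e -> 0 <= r ->
  (1 + r) `^ m <= expR (m * ln (m / e + 1) + e) * expR (e * r).
Proof.
move=> m0 e0 r0; have r1 : 0 < 1 + r by rewrite ltr_pwDl.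
have b1 : 0 < m / e + 1 by rewrite ltr_wpDl// divr_ge0// ltW.
rewrite /powR gt_eqF// -expRD ler_expR.
have : ln ((1 + r) / (m / e + 1)) <= (1 + r) / (m / e + 1) - 1.
  have := @le_ln1Dx R ((1 + r) / (m / e + 1) - 1).
  by rewrite [1 + (_ - 1)]addrC subrK; apply; rewrite ltrBrDl subrr divr_gt0.
rewrite lnM ?posrE ?invr_gt0// lnV ?posrE// => H.
have := ler_wpM2l m0 H; rewrite !mulrBr mulr1.
suff : m * ((1 + r) / (m / e + 1)) <= e * (1 + r) by lra.
rewrite mulrA ler_pdivrMr//.
have -> : e * (1 + r) * (m / e + 1) = m * (1 + r) + e * (1 + r).
  by field; rewrite gt_eqF.
by rewrite lerDl mulr_ge0// ltW.
Qed.

Lemma norm_dot_le (R : realType) (d : nat) (a x : 'rV[R]_d) :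
  `|dot a x| <= (dot a a + 1) * (1 + dot x x).
Proof.
have aa := dot_ge0 a; have xx := dot_ge0 x.
have h1 := dot_ge0 (a + x); have h2 := dot_ge0 (a - x).
rewrite !dotDl !dotDr (dotC x a) in h1.
rewrite !dotBl !dotBr (dotC x a) in h2.
have : `|dot a x| <= (dot a a + dot x x) / 2 by rewrite ler_norml; apply/andP; split; lra.
have := mulr_ge0 aa xx; lra.
Qed.

Lemma dunkl_weight_ge0 (R : realType) (d : nat) (Pos : {fset 'rV[R]_d}) k x :
  0 <= dunkl_weight Pos k x.
Proof. by apply: prodr_ge0 => a _; exact: powR_ge0. Qed.

(** The weight is [O(exp(3 / 8 |x|^2))]; the remaining [exp(- |x|^2 / 8)] is a multiple of a product
    of normal densities of standard deviation 2. *)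
Lemma dunkl_c_integral_fin (R : realType) (d : nat) (Pos : {fset 'rV[R]_d}) (k : R) :
  0 < k -> exists C : R, (integral_Rn (fun x : 'rV[R]_d =>
    (expR (- enorm x ^+ 2 / 2) * dunkl_weight Pos k x)%:E) <= C%:E)%E.
Proof.
move=> k0.
have k20 : 0 <= 2 * k by rewrite mulr_ge0// ltW.
have [C C0 HC] : exists2 C : R, 0 <= C & forall x : 'rV[R]_d,
    dunkl_weight Pos k x <= C * expR (3 / 8 * dot x x).
  rewrite /dunkl_weight; set m := 2 * k in k20 *.
  (* The exponent 3/8 is shared among the factors; the successor avoids a zero denominator. *)
  pose e : R := 3 / 8 / (size Pos).+1%:R.
  have e0 : 0 < e by rewrite !divr_gt0.
  have H a (x : 'rV[R]_d) : `|dot a x| `^ m <=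
      ((dot a a + 1) `^ m * expR (m * ln (m / e + 1) + e)) * expR (e * dot x x).
    have a1 : 0 <= dot a a + 1 by rewrite addr_ge0// dot_ge0.
    apply: (@le_trans _ _ (((dot a a + 1) * (1 + dot x x)) `^ m)).
      by apply: ge0_ler_powR; rewrite // ?nnegrE ?mulr_ge0 ?norm_dot_le// addr_ge0// dot_ge0.
    rewrite powRM ?addr_ge0 ?dot_ge0// -mulrA ler_wpM2l ?powR_ge0//.
    by apply: powR_le_expR => //; exact: dot_ge0.
  exists (\prod_(a <- Pos) ((dot a a + 1) `^ m * expR (m * ln (m / e + 1) + e))).
    by apply: prodr_ge0 => a _; rewrite mulr_ge0 ?powR_ge0 ?expR_ge0.
  move=> x; apply: (@le_trans _ _ (\prod_(a <- Pos) (((dot a a + 1) `^ m *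
      expR (m * ln (m / e + 1) + e)) * expR (e * dot x x)))).
    by apply: ler_prod => a _; rewrite powR_ge0 H.
  rewrite big_split/=; apply: ler_wpM2l.
    by apply: prodr_ge0 => a _; rewrite mulr_ge0 ?powR_ge0 ?expR_ge0.
  rewrite -expR_sum ler_expR big_const_seq count_predT iter_addr_0 -[leLHS]mulr_natr.
  rewrite [leLHS]mulrAC ler_wpM2r ?dot_ge0// /e [leLHS]mulrAC.
  by rewrite ler_pdivrMr// ler_wpM2l// ler_nat.
pose P := @normal_peak R 2.
have P0 : 0 < P by exact: normal_peak_gt0.
exists (C / P ^+ d * \prod_(i < d) 1).
have CP0 : 0 <= C / P ^+ d by rewrite divr_ge0// exprn_ge0// ltW.
rewrite -(@integral_Rn_prod R d (fun _ => normal_pdf 0 2) (fun _ => 1))//; last 3 first.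
- by move=> i t; exact: normal_pdf_ge0.
- by move=> i; exact: measurable_normal_pdf.
- by move=> i; rewrite integral_normal_pdf.
apply: integral_Rn_le => x.
  by rewrite lee_fin mulr_ge0 ?expR_ge0// dunkl_weight_ge0.
rewrite lee_fin; apply: le_trans (ler_wpM2l (expR_ge0 _) (HC x)) _.
rewrite [leLHS]mulrCA -expRD enorm_sqr -[leRHS]mulrA ler_wpM2l//.
have -> : - dot x x / 2 + 3 / 8 * dot x x = \sum_(i < d) (- (x 0 i - 0) ^+ 2 / (2 ^+ 2 *+ 2)).
  rewrite -mulr_suml sumrN /dot.
  rewrite (eq_bigr (fun i => (x 0 i - 0) ^+ 2)); last by move=> i _; rewrite subr0 expr2.
  by field.
rewrite expR_sum.
rewrite [X in _ <= _ * X](eq_bigr (fun i => P * expR (- (x 0 i - 0) ^+ 2 / (2 ^+ 2 *+ 2)))); last first.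
  by move=> i _; rewrite normal_pdfE.
rewrite big_split/= prodr_const card_ord mulrA mulVf ?mul1r//.
by rewrite expf_neq0// gt_eqF.
Qed.

(** On a cube of half-width [de] around [x0] each [<a, x>] is at least 1/2, so the integrand
    dominates a multiple of the indicator of the cube. *)
Lemma dunkl_c_integral_gt0 (R : realType) (d : nat) (Pos : {fset 'rV[R]_d}) (k : R)
    (x0 : 'rV[R]_d) :
  0 < k -> (forall a, a \in Pos -> 1 <= dot a x0) ->
  exists2 c : R, 0 < c & (c%:E <= integral_Rn (fun x : 'rV[R]_d =>
    (expR (- enorm x ^+ 2 / 2) * dunkl_weight Pos k x)%:E))%E.
Proof.
move=> k0 Px0.
pose l1 (a : 'rV[R]_d) := \sum_i `|a 0 i|.
have l10 a : 0 <= l1 a by apply: sumr_ge0.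
pose S := \sum_(a <- Pos) l1 a.
have S0 : 0 <= S by apply: sumr_ge0.
pose de := (2 * (S + 1))^-1.
have de0 : 0 < de by rewrite invr_gt0 mulr_gt0// ltr_wpDl.
pose h (i : 'I_d) : R -> R := \1_(`[x0 0 i - de, x0 0 i + de]%classic).
pose M := \sum_i (`|x0 0 i| + de) ^+ 2.
pose c := expR (- M / 2) * \prod_(a <- Pos) (2^-1 : R) `^ (2 * k).
have c0 : 0 < c.
  by rewrite mulr_gt0 ?expR_gt0//; apply: prodr_gt0 => a _; rewrite powR_gt0 ?invr_gt0.
exists (c * \prod_(i < d) (2 * de)).
  by rewrite mulr_gt0//; apply: prodr_gt0 => i _; rewrite mulr_gt0.
rewrite -(@integral_Rn_prod R d h (fun _ => 2 * de) c (ltW c0)); last 3 first.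
- by move=> i t; rewrite /h indicE.
- by move=> i; apply: measurable_indic.
- move=> i; rewrite /h integral_indic// setIT.
  transitivity (lebesgue_measure `[x0 0 i - de, x0 0 i + de]%classic) => //.
  rewrite lebesgue_measure_itv/= lte_fin ltrD2l gtrN// -EFinB; congr (_%:E); ring.
apply: integral_Rn_le => x.
  by rewrite lee_fin mulr_ge0 ?(ltW c0)//; apply: prodr_ge0 => i _; rewrite /h indicE.
rewrite lee_fin.
have [box|nbox] := pselect (forall i, `[x0 0 i - de, x0 0 i + de]%classic (x 0 i)); last first.
  have [i ni] : exists i, ~ `[x0 0 i - de, x0 0 i + de]%classic (x 0 i).
    by apply: contrapT => H; apply: nbox => i; apply: contrapT => ni; apply: H; exists i.
  rewrite (bigD1 i)//= {1}/h indicE memNset// mul0r mulr0.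
  by rewrite mulr_ge0 ?expR_ge0// dunkl_weight_ge0.
have xx0 i : `|x 0 i - x0 0 i| <= de.
  by have := box i; rewrite /= in_itv/= => /andP[? ?]; rewrite ler_norml; apply/andP; split; lra.
rewrite (eq_bigr (fun=> 1)); last by move=> i _; rewrite /h indicE mem_set.
rewrite big1// mulr1 /c; apply: ler_pM.
- exact: expR_ge0.
- by apply: prodr_ge0 => a _; exact: powR_ge0.
- rewrite ler_expR ler_pM2r ?invr_gt0// lerN2 enorm_sqr /dot /M; apply: ler_sum => i _.
  rewrite -expr2 -[x 0 i ^+ 2]real_normK ?num_real//.
  apply: lerXn2r; rewrite ?nnegrE ?addr_ge0// ?(ltW de0)//.
  by have := ler_normD (x0 0 i) (x 0 i - x0 0 i); rewrite addrC subrK; have := xx0 i; lra.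
rewrite /dunkl_weight big_seq [leRHS]big_seq; apply: ler_prod => a aP.
rewrite powR_ge0/=; apply: ge0_ler_powR; rewrite ?nnegrE//.
  by rewrite mulr_ge0// ltW.
have : `|dot a (x - x0)| <= l1 a * de.
  apply: le_trans (ler_norm_sum _ _ _) _; rewrite mulr_suml; apply: ler_sum => i _.
  by rewrite normrM ler_wpM2l// !mxE.
have : l1 a * de <= 2^-1.
  have aS : l1 a <= S.
    by rewrite /S (bigD1_seq a)//= lerDl; apply: sumr_ge0.
  rewrite /de ler_pdivrMr; last by rewrite mulr_gt0// ltr_wpDl.
  by rewrite mulrA mulVf// mul1r; lra.
rewrite dotBr ler_norml => H /andP[H1 H2]; have := Px0 a aP => H3.
by apply: le_trans (ler_norm _); lra.
Qed.

(** * Integration in time *)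

Section TimeIntegral.
Context {R : realType} {T : eqType}.
Implicit Types (b k D t : R) (q : T -> R) (r : seq T).

Local Notation mu := (@lebesgue_measure R).

Lemma integral_ge_interval (f : R -> R) (m a : R) : 0 < a -> 0 <= m ->
  (forall t, 0 < t -> 0 <= f t) -> (forall t, a <= t <= 2 * a -> m <= f t) ->
  ((m * a)%:E <= \int[mu]_(t in [set` `]0%R, +oo[]) (f t)%:E)%E.
Proof.
move=> a0 m0 f0 fm.
have E : (\int[mu]_(t in [set` `]0%R, +oo[]) (m%:E * (\1_(`[a, 2 * a]%classic) t)%:E) = (m * a)%:E)%E.
  rewrite ge0_integralZl//=.
  - rewrite integral_indic//= setIidl; last first.
      by move=> t /=; rewrite !in_itv/= andbT => /andP[+ _]; exact: lt_le_trans.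
    transitivity (m%:E * mu `[a, (2 * a)%R]%classic)%E => //.
    rewrite lebesgue_measure_itv/= lte_fin ltr_pMl// ltr1n -EFinB -EFinM.
    by congr (_%:E); ring.
  - by apply/measurable_EFinP; exact: measurable_indic.
rewrite -E; apply: ge0_le_integral_nomeas => t /=; rewrite in_itv/= andbT => t0.
  by rewrite -EFinM lee_fin mulr_ge0// indicE.
rewrite -EFinM lee_fin indicE; case: (boolP (t \in _)) => [|_]; last first.
  by rewrite mulr0 f0.
by rewrite inE/= in_itv/= mulr1 => /fm.
Qed.

Lemma integral_shifted_power b D : 1 < b -> 0 < D ->
  (\int[mu]_(t in [set` `]0%R, +oo[]) (expR (- (b * ln (D + t))))%:E =
    (expR ((1 - b) * ln D) / (b - 1))%:E)%E.
Proof.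
move=> b1 D0; have b10 : 0 < b - 1 by rewrite subr_gt0.
pose F (t : R) := - (b - 1)^-1 * expR ((1 - b) * ln (D + t)).
have dln t : 0 <= t -> is_derive t 1 (fun t : R => ln (D + t)) (D + t)^-1.
  move=> t0; have H := is_derive_lnf (f := fun t : R => D + t) (t := t) _
    (is_derive_addf (is_derive_cst D t (1 : R)) (is_derive_id t (1 : R))).
  by apply: (is_derive_eq (H _)); rewrite ?add0r ?mul1r// ltr_pwDl.
have dF t : 0 <= t -> is_derive t 1 F (expR (- (b * ln (D + t)))).
  move=> t0; have H := is_derive_scalef (- (b - 1)^-1)
    (is_derive_expRf (is_derive_scalef (1 - b) (dln t t0))).
  apply: (is_derive_eq H); have Dt : 0 < D + t by rewrite ltr_pwDl.
  have -> : (1 - b) * ln (D + t) = ln (D + t) + - (b * ln (D + t)) by ring.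
  rewrite expRD lnK ?posrE//; field.
  by rewrite !gt_eqF.
have df t : 0 <= t -> {for t, continuous (fun t => expR (- (b * ln (D + t))))}.
  move=> t0; exact: is_derive_continuous
    (is_derive_expRf (is_derive_oppf (is_derive_scalef b (dln t t0)))).
have -> : (expR ((1 - b) * ln D) / (b - 1))%:E = (0%:E - (F 0)%:E)%E.
  by rewrite -EFinB /F addr0; congr (_%:E); ring.
rewrite integral_itv_obnd_cbnd; last first.
  apply/measurable_EFinP; apply: measurableT_comp => //; apply: measurable_funN.
  apply: measurable_funM => //; apply: measurable_funTS.
  by apply: measurableT_comp => //; exact: measurable_funD.
apply: ge0_continuous_FTC2y.
- by move=> t _; exact: expR_ge0.
- apply: continuous_in_subspaceT => t; rewrite inE/= in_itv/= andbT; exact: df.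
- have -> : (0 : R) = - (b - 1)^-1 * 0 by rewrite mulr0.
  apply: cvgMr; apply/cvgrPdist_lt => e e0; near=> t.
  rewrite sub0r normrN ger0_norm ?expR_ge0// -[ltRHS](@lnK _ e)// ltr_expR.
  (* Beyond this threshold [(1 - b) ln (D + t) < ln e]. *)
  have tl : expR (- ln e / (b - 1)) < t by near: t; exact: nbhs_pinfty_gt.
  have t0 : 0 < t by apply: lt_trans tl; exact: expR_gt0.
  have : - ln e / (b - 1) < ln (D + t).
    rewrite -[ltLHS]expRK ltr_ln ?posrE ?expR_gt0//; last by rewrite addr_gt0.
    by apply: lt_le_trans tl _; rewrite lerDr ltW.
  by rewrite ltr_pdivrMr//; lra.
- by move=> t t0; have [] := dF t (ltW t0).
- apply: cvg_at_right_filter; exact: is_derive_continuous (dF 0 (lexx _)).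
- move=> t; rewrite in_itv/= andbT => /ltW t0.
  by rewrite derive1E; have [_ ->] := dF t t0.
Unshelve. all: by end_near.
Qed.

(** The shape of the heat kernel for [b = d / 2], [D = |X - Y|^2] and [q a = <a, X> <a, Y>], as one
    exponential so that estimates are linear in logarithms. *)
Definition heat_profile b k r q D t : R :=
  expR (- (b * ln t) - D / (4 * t) - k * \sum_(a <- r) ln (t + q a / 2)).

Lemma sum_cst_seq r (c : R) : \sum_(a <- r) c = (size r)%:R * c.
Proof. by rewrite big_const_seq count_predT iter_addr_0 mulr_natl. Qed.

(** [D'] is separate from [D] so that the case [D = 0] is covered with arbitrarily short time
    windows. *)
Lemma heat_profile_ge b k r q D D' t :
  0 <= b -> 0 <= k -> (forall a, a \in r -> 0 <= q a) ->
  0 < D' -> 0 <= D <= D' -> D' <= t <= 2 * D' ->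
  expR (- (b * (ln 2 + ln D')) - 1 / 4 - k * \sum_(a <- r) (ln 2 + ln (D' + 2 * q a))) <=
  heat_profile b k r q D t.
Proof.
move=> b0 k0 q0 D'0 /andP[D0 DD'] /andP[t1 t2]; have t0 : 0 < t by apply: lt_le_trans t1.
rewrite ler_expR; apply: lerB; first apply: lerB.
- rewrite lerN2 ler_wpM2l// -lnM ?posrE// ler_ln ?posrE// mulr_gt0//.
- by rewrite ler_pdivrMr ?mulr_gt0//; lra.
rewrite ler_wpM2l// big_seq [leRHS]big_seq; apply: ler_sum => a ar.
have qa := q0 a ar.
rewrite -lnM ?posrE//; last by rewrite ltr_pwDl// mulr_ge0.
by rewrite ler_ln ?posrE; lra.
Qed.

(** For [t > D] the factors compare termwise. For [t <= D], replacing [t] by [D] in the powers costs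
    a constant times [(D / t)^al], which [exp(- D / (4 t))] absorbs. *)
Lemma heat_profile_le b k r q D t (al := b + k * (size r)%:R) :
  0 < b -> 0 <= k -> (forall a, a \in r -> 0 <= q a) -> 0 < D -> 0 < t ->
  heat_profile b k r q D t <=
  expR (b * ln 2 + k * (size r)%:R * ln 4 + al * `|ln (4 * al)|) *
  expR (- (k * \sum_(a <- r) ln (D + 2 * q a))) * expR (- (b * ln (D + t))).
Proof.
move=> b0 k0 q0 D0 t0; rewrite -!expRD ler_expR.
have g0 : 0 <= k * (size r)%:R by rewrite mulr_ge0.
have al0 : 0 < al by rewrite ltr_wpDr.
have N0 : 0 <= al * `|ln (4 * al)| by rewrite mulr_ge0// ltW.
have Dt : 0 < D + t by rewrite addr_gt0.
have [tD|Dt'] := leP t D.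
  have h1 : ln (D + t) <= ln 2 + ln D.
    by rewrite -lnM ?posrE// ler_ln ?posrE ?mulr_gt0//; lra.
  have h2 : \sum_(a <- r) ln (D + 2 * q a) + (size r)%:R * (ln t - ln D - ln 4) <=
      \sum_(a <- r) ln (t + q a / 2).
    rewrite -sum_cst_seq -big_split/= big_seq [leRHS]big_seq; apply: ler_sum => a ar.
    have qa := q0 a ar.
    have e1 : 0 < D + 2 * q a by rewrite ltr_pwDl// mulr_ge0.
    have e2 : 0 < t + q a / 2 by rewrite ltr_pwDl// divr_ge0.
    rewrite -!lnV ?posrE// -!lnM ?posrE ?mulr_gt0 ?invr_gt0//.
    rewrite ler_ln ?posrE ?mulr_gt0 ?invr_gt0//.
    have -> : (D + 2 * q a) * (t * D^-1 * 4^-1) = t / 4 + (t / D) * (q a / 2).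
      by field; rewrite gt_eqF.
    have tD1 : t / D <= 1 by rewrite ler_pdivrMr// mul1r.
    have : (t / D) * (q a / 2) <= 1 * (q a / 2) by rewrite ler_wpM2r// divr_ge0.
    lra.
  have {}h2 := ler_wpM2l k0 h2.
  (* With [u = D / t], the maximum of [al ln u - u / 4] is bounded through [ln y <= y - 1] at
     [y = u / (4 al)]. *)
  have h3 : al * (ln D - ln t) - D / (4 * t) <= al * `|ln (4 * al)|.
    have y0 : 0 < D / t / (4 * al) by rewrite !divr_gt0// mulr_gt0.
    have : ln (D / t / (4 * al)) <= D / t / (4 * al) - 1.
      have := @le_ln1Dx R (D / t / (4 * al) - 1).
      by rewrite [1 + (_ - 1)]addrC subrK; apply; rewrite ltrBrDl subrr.
    rewrite lnM ?posrE ?divr_gt0 ?invr_gt0 ?mulr_gt0//.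
    rewrite ln_div ?posrE// lnV ?posrE ?mulr_gt0//.
    move/(ler_wpM2l (ltW al0)).
    have -> : al * (D / t / (4 * al) - 1) = D / (4 * t) - al.
      by field; rewrite !gt_eqF.
    have := ler_wpM2l (ltW al0) (ler_norm (ln (4 * al))).
    lra.
  have {}h1 := ler_wpM2l (ltW b0) h1.
  move: h1 h2 h3; rewrite /al; move: (\sum_(a <- r) _) (\sum_(a <- r) _) => S1 S2.
  lra.
have h1 : ln (D + t) <= ln 2 + ln t.
  by rewrite -lnM ?posrE// ler_ln ?posrE ?mulr_gt0//; lra.
have h2 : \sum_(a <- r) ln (D + 2 * q a) - (size r)%:R * ln 4 <=
    \sum_(a <- r) ln (t + q a / 2).
  rewrite -mulrN -sum_cst_seq -big_split/= big_seq [leRHS]big_seq; apply: ler_sum => a ar.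
  have qa := q0 a ar.
  have e1 : 0 < D + 2 * q a by rewrite ltr_pwDl// mulr_ge0.
  have e2 : 0 < t + q a / 2 by rewrite ltr_pwDl// divr_ge0.
  rewrite -lnV ?posrE// -lnM ?posrE ?invr_gt0//.
  rewrite ler_ln ?posrE ?mulr_gt0 ?invr_gt0//; lra.
have h3 : 0 <= D / (4 * t) by rewrite divr_ge0 ?mulr_ge0// ltW.
have {}h2 := ler_wpM2l k0 h2; have {}h1 := ler_wpM2l (ltW b0) h1.
move: h1 h2 h3; move: (\sum_(a <- r) _) (\sum_(a <- r) _) => S1 S2.
lra.
Qed.

End TimeIntegral.

(** * Bounds for the heat kernel and the Newton kernel *)

Lemma dunkl_c_gt0 (R : realType) (n d : nat) (Sigma Pos : {fset 'rV[R]_d}) (k : R) :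
  root_system_A n Sigma Pos -> 0 < k -> 0 < dunkl_c Pos k.
Proof.
move=> /root_system_A_frame[g [gf _ PosP]] k0.
(* The root [g i - g j] takes the value [j - i] at [x0]. *)
pose x0 := \sum_(l < n.+1) (- (l%:R : R)) *: g l.
have Px0 a : a \in Pos -> 1 <= dot a x0.
  move=> /PosP[i [j [ij ->]]]; rewrite /x0 dot_sumr.
  rewrite (eq_bigr (fun l : 'I_n.+1 => - (l%:R : R) * ((i == l)%:R - (j == l)%:R))); last first.
    by move=> l _; rewrite dotZr dotBl !gf.1; congr (_ * _); ring.
  under eq_bigr do rewrite mulrBr.
  have S (m : 'I_n.+1) : \sum_(l < n.+1) - (l%:R : R) * (m == l)%:R = - (m%:R : R).
    rewrite (bigD1 m)//= eqxx mulr1 big1 ?addr0// => l.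
    by rewrite eq_sym => /negbTE->; rewrite mulr0.
  by rewrite sumrB !S opprK addrC lerBrDr nat1r ler_nat.
have [C HC] := @dunkl_c_integral_fin R d Pos k k0.
have [c c0 Hc] := @dunkl_c_integral_gt0 R d Pos k x0 k0 Px0.
(* [fine] maps infinite values to 0, so finiteness of the integral matters here as well as
   positivity. *)
rewrite /dunkl_c; set I := integral_Rn _ in HC Hc *.
case: I HC Hc => [r|//|//]; rewrite !lee_fin/= => _; exact: lt_le_trans.
Qed.

(** Rescaling turns [1 + <a, X> <a, Y> / (2 t)] into [(t + q a / 2) / t]; the resulting powers of
    [t] cancel [t^(- gamma)], and the quadratic exponents combine to [- |X - Y|^2 / (4 t)]. *)
Lemma heat_kernel_bounds (R : realType) (n d : nat) (Sigma Pos : {fset 'rV[R]_d})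
    (k : R) (E : 'rV[R]_d -> 'rV[R]_d -> R) :
  root_system_A n Sigma Pos -> 0 < k -> is_dunkl_kernel Pos k E ->
  exists c1 c2 : R, [/\ 0 < c1, 0 < c2 & forall X Y t,
    (forall a, a \in Pos -> 0 <= dot a X) -> (forall a, a \in Pos -> 0 <= dot a Y) ->
    0 < t ->
    let H := heat_profile (d%:R / 2) k Pos (fun a => dot a X * dot a Y)
      (dot (X - Y) (X - Y)) t in
    c1 * H <= heat_kernel Sigma Pos k E t X Y /\ heat_kernel Sigma Pos k E t X Y <= c2 * H].
Proof.
move=> hA k0 hE; have [C1 [C2 [C10 C20 HC]]] := spherical_bounds hA k0 hE.
have c0 := dunkl_c_gt0 hA k0.
pose A := (2 `^ (dunkl_gamma Pos k + d%:R / 2) * dunkl_c Pos k)^-1.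
have A0 : 0 < A by rewrite invr_gt0 mulr_gt0// powR_gt0.
exists (A * C1), (A * C2); split; [exact: mulr_gt0|exact: mulr_gt0|].
move=> X Y t PX PY t0 H.
have s0 : 0 < (2 * t)^-1 by rewrite invr_gt0 mulr_gt0.
have PY' a : a \in Pos -> 0 <= dot a ((2 * t)^-1 *: Y).
  by move=> aP; rewrite dotZr mulr_ge0 ?(ltW s0)// PY.
have := HC _ _ PY' PX; cbv zeta; set B := expR _.
have HB : t `^ (- (d%:R / 2) - dunkl_gamma Pos k) *
    expR (- (enorm X ^+ 2 + enorm Y ^+ 2) / (4 * t)) * B = H.
  rewrite /powR gt_eqF// /B -!expRD /H /heat_profile; congr expR.
  have -> : \sum_(a <- Pos) ln (1 + dot a ((2 * t)^-1 *: Y) * dot a X) =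
      \sum_(a <- Pos) ln (t + dot a X * dot a Y / 2) - (size Pos)%:R * ln t.
    rewrite -sum_cst_seq -sumrB big_seq [RHS]big_seq; apply: eq_bigr => a aP.
    have q0 : 0 <= dot a X * dot a Y by rewrite mulr_ge0 ?PX ?PY.
    have e1 : 0 < t + dot a X * dot a Y / 2 by rewrite ltr_pwDl// divr_ge0.
    rewrite -ln_div ?posrE// dotZr; congr ln; field.
    by rewrite gt_eqF.
  rewrite !enorm_sqr dotBl !dotBr dotZl (dotC Y X) /dunkl_gamma.
  move: (\sum_(a <- Pos) _) => S; field.
  by rewrite gt_eqF.
have P0 : 0 < t `^ (- (d%:R / 2) - dunkl_gamma Pos k) *
    expR (- (enorm X ^+ 2 + enorm Y ^+ 2) / (4 * t)).
  by rewrite mulr_gt0 ?powR_gt0 ?expR_gt0.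
move: HB P0; rewrite /heat_kernel -/A; set P := t `^ _; set Q := expR _ => HB P0.
move=> /andP[h1 h2].
have AP0 : 0 < A * (P * Q) by rewrite mulr_gt0.
rewrite -[A * P * Q * _]/(A * P * Q * _) -HB.
have -> : A * C1 * (P * Q * B) = A * (P * Q) * (C1 * B) by ring.
have -> : A * C2 * (P * Q * B) = A * (P * Q) * (C2 * B) by ring.
by rewrite -(mulrA A P Q); split; rewrite ler_wpM2l// ltW.
Qed.

Lemma dot_reflection (R : realType) (d : nat) (a X Y : 'rV[R]_d) : dot a a = 2 ->
  dot (X - reflection a Y) (X - reflection a Y) =
  dot (X - Y) (X - Y) + 2 * (dot a X * dot a Y).
Proof.
move=> a2; rewrite /reflection a2 mulrAC divff// mul1r opprB addrA.
rewrite !(dotDl, dotDr, dotNl, dotNr, dotZl, dotZr) a2 (dotC Y X) (dotC X a) (dotC Y a).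
by ring.
Qed.

Lemma enorm_powR (R : realType) (d : nat) (X : 'rV[R]_d) (p : R) : 0 < dot X X ->
  enorm X `^ p = expR (p / 2 * ln (dot X X)).
Proof.
move=> X0; have e0 : 0 < enorm X by rewrite sqrtr_gt0.
rewrite /powR gt_eqF//; congr expR.
by rewrite -enorm_sqr lnXn// -mulr_natr; field.
Qed.

Lemma newton_bound_offdiag (R : realType) (d : nat) (Pos : {fset 'rV[R]_d}) (k : R)
    (X Y : 'rV[R]_d) :
  (forall a, a \in Pos -> dot a a = 2) ->
  (forall a, a \in Pos -> 0 <= dot a X) -> (forall a, a \in Pos -> 0 <= dot a Y) ->
  X != Y ->
  let D := dot (X - Y) (X - Y) in
  newton_bound Pos k X Y = (expR ((1 - d%:R / 2) * ln D) *
    expR (- (k * \sum_(a <- Pos) ln (D + 2 * (dot a X * dot a Y)))))%:E.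
Proof.
move=> P2 PX PY XY D.
have D0 : 0 < D by rewrite lt_neqAle dot_ge0 eq_sym dot_eq0 subr_eq0 XY.
rewrite /newton_bound (negbTE XY); congr (_%:E); rewrite enorm_powR//; congr (_ * _).
  by have -> : (2 - d%:R) / 2 = 1 - d%:R / 2 :> R by field.
rewrite expRN mulr_sumr expR_sum; congr (_^-1); rewrite big_seq [RHS]big_seq.
apply: eq_bigr => a aP; have R2 := dot_reflection X Y (P2 a aP).
rewrite enorm_powR R2; last by rewrite ltr_pwDl// !mulr_ge0 ?PX ?PY.
by have -> : 2 * k / 2 = k by field.
Qed.

(** The window [[D', 2 D']] contributes at least a fixed multiple of [D'^(1 - b)] for [D' <= 1],
    which is unbounded as [D'] tends to 0 because [b > 1]. *)
Lemma newton_kernel_diag (R : realType) (n d : nat) (Sigma Pos : {fset 'rV[R]_d})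
    (k : R) (E : 'rV[R]_d -> 'rV[R]_d -> R) (c1 : R) X :
  (3 <= d)%N -> 0 < k -> 0 < c1 ->
  (forall a, a \in Pos -> 0 <= dot a X) ->
  (forall t, 0 < t -> 0 <= heat_kernel Sigma Pos k E t X X) ->
  (forall t, 0 < t -> c1 * heat_profile (d%:R / 2) k Pos (fun a => dot a X * dot a X) 0 t <=
    heat_kernel Sigma Pos k E t X X) ->
  newton_kernel Sigma Pos k E X X = +oo%E.
Proof.
move=> d3 k0 c10 PX H0 H1; apply/eqyP => M _.
have q0 a : a \in Pos -> 0 <= dot a X * dot a X by move=> aP; rewrite mulr_ge0 ?PX.
have b1 : 0 < d%:R / 2 - 1 :> R.
  have : 3 <= d%:R :> R by rewrite ler_nat.
  lra.
set b : R := d%:R / 2 in b1 H1.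
pose K0 := - (b * ln 2) - 1 / 4 - k * \sum_(a <- Pos) (ln 2 + ln (1 + 2 * (dot a X * dot a X))).
(* Chosen so that [ln (m * D') >= K0 + (b - 1) L >= |M| / c1]; [K0] collects the terms bounded below
   for [D' <= 1]. *)
pose L := (`|M| / c1 + `|K0|) / (b - 1).
have L0 : 0 <= L by rewrite divr_ge0 ?(ltW b1)// addr_ge0// divr_ge0// ltW.
pose D' := expR (- L).
have D'0 : 0 < D' by exact: expR_gt0.
have D'1 : D' <= 1 by rewrite -[leRHS]expR0 ler_expR oppr_le0.
pose m := expR (- (b * (ln 2 + ln D')) - 1 / 4 -
  k * \sum_(a <- Pos) (ln 2 + ln (D' + 2 * (dot a X * dot a X)))).
rewrite /newton_kernel.
have cm0 : 0 <= c1 * m by rewrite mulr_ge0 ?(ltW c10)// expR_ge0.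
apply: le_trans; last first.
  apply: (integral_ge_interval D'0 cm0 H0) => t tI.
  have t0 : 0 < t by case/andP: tI => + _; apply: lt_le_trans.
  apply: le_trans (H1 t t0); rewrite ler_wpM2l ?(ltW c10)//.
  apply: heat_profile_ge => //; rewrite ?lexx ?(ltW D'0) ?(ltW k0)//; lra.
- rewrite lee_fin -mulrA -ler_pdivrMl// -[D' in leRHS]/(expR (- L)) -expRD.
  apply: le_trans (expR_ge1Dx _).
  have -> : ln D' = - L by rewrite expRK.
  have hS : \sum_(a <- Pos) (ln 2 + ln (D' + 2 * (dot a X * dot a X))) <=
      \sum_(a <- Pos) (ln 2 + ln (1 + 2 * (dot a X * dot a X))).
    rewrite big_seq [leRHS]big_seq; apply: ler_sum => a aP; have qa := q0 a aP.
    by rewrite lerD2l ler_ln ?posrE; lra.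
  have {}hS := ler_wpM2l (ltW k0) hS.
  have hL : (b - 1) * L = `|M| / c1 + `|K0|.
    by rewrite /L; field; rewrite !gt_eqF.
  have hM : c1^-1 * M <= `|M| / c1.
    by rewrite mulrC ler_wpM2r ?invr_ge0 ?(ltW c10)// ler_norm.
  have hK : - K0 <= `|K0| by rewrite lerNl lerNnormlW.
  move: hL hM hK hS; rewrite /K0; move: (\sum_(a <- Pos) _) (\sum_(a <- Pos) _) => S1 S2.
  lra.
Qed.

Theorem theorem3p6 (R : realType) (n d : nat)
  (hn : (1 <= n)%N) (hd3 : (3 <= d)%N) (hdn : (n <= d)%N)
  (Sigma Pos : {fset 'rV[R]_d}) (hA : root_system_A n Sigma Pos)
  (k : R) (hk : 0 < k)
  (E : 'rV[R]_d -> 'rV[R]_d -> R) (hE : is_dunkl_kernel Pos k E) :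
  comparable_on (closure (chamber Pos) `*` closure (chamber Pos))
    (fun XY => newton_kernel Sigma Pos k E XY.1 XY.2)
    (fun XY => newton_bound Pos k XY.1 XY.2).
Proof.
have [g [gf SigmaP PosP]] := root_system_A_frame hA.
have P2 a : a \in Pos -> dot a a = 2.
  by move=> /PosP[i [j [ij ->]]]; rewrite dot_root_root// -val_eqE/= ltn_eqF.
have [c1 [c2 [c10 c20 Hc]]] := heat_kernel_bounds hA hk hE.
pose b : R := d%:R / 2; pose N : R := (size Pos)%:R.
have b1 : 1 < b.
  have : 3 <= d%:R :> R by rewrite ler_nat.
  by rewrite /b; lra.
have b0 : 0 < b by apply: lt_trans b1.
(* [m] collects the losses on the window [[D, 2 D]] and [M] those of [heat_profile_le]; the factor
   [(b - 1)^-1] below comes from [integral_shifted_power]. *)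
pose m := expR (- (b * ln 2) - 1 / 4 - k * (N * ln 2)).
pose M := expR (b * ln 2 + k * N * ln 4 + (b + k * N) * `|ln (4 * (b + k * N))|).
exists (c1 * m), (c2 * M / (b - 1)); split.
- by rewrite mulr_gt0// expR_gt0.
- by rewrite divr_gt0 ?subr_gt0// mulr_gt0// expR_gt0.
move=> [X Y] [/= XC YC].
have PX a := @closure_chamber_dot_ge0 R d Pos a X XC.
have PY a := @closure_chamber_dot_ge0 R d Pos a Y YC.
have H1 t (t0 : 0 < t) := Hc X Y t PX PY t0.
pose q a := dot a X * dot a Y.
have q0 a : a \in Pos -> 0 <= q a by move=> aP; rewrite mulr_ge0 ?PX ?PY.
have H0 t : 0 < t -> 0 <= heat_kernel Sigma Pos k E t X Y.
  move=> t0; have [+ _] := H1 t t0; apply: le_trans.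
  by rewrite mulr_ge0 ?(ltW c10) ?expR_ge0.
have [XY|XY] := eqVneq X Y.
  move: H0 H1; rewrite -XY => H0 H1.
  rewrite (@newton_kernel_diag R n d Sigma Pos k E c1 X)//; last first.
    by move=> t t0; have [+ _] := H1 t t0; rewrite subrr dot0l.
  rewrite /newton_bound eqxx !gt0_muley ?lexx// lte_fin.
  - by rewrite divr_gt0 ?subr_gt0// mulr_gt0// expR_gt0.
  - by rewrite mulr_gt0// expR_gt0.
rewrite (@newton_bound_offdiag R d Pos k X Y P2 PX PY XY); set D := dot (X - Y) (X - Y) in H1 *.
have D0 : 0 < D by rewrite lt_neqAle dot_ge0 eq_sym dot_eq0 subr_eq0 XY.
set e1 := expR ((1 - d%:R / 2) * ln D); set e2 := expR (- (k * _)).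
rewrite -!EFinM; apply/andP; split.
  have := @integral_ge_interval R (fun t => heat_kernel Sigma Pos k E t X Y)
    (c1 * expR (- (b * (ln 2 + ln D)) - 1 / 4 -
      k * \sum_(a <- Pos) (ln 2 + ln (D + 2 * q a)))) D D0 _ H0.
  (* The window has length [D], which turns [D^(- b)] into the power [D^(1 - b)] of the Newton
     bound. *)
  have -> : c1 * expR (- (b * (ln 2 + ln D)) - 1 / 4 -
      k * \sum_(a <- Pos) (ln 2 + ln (D + 2 * q a))) * D = c1 * m * (e1 * e2).
    rewrite -[X in _ * X = _](@lnK _ D) ?posrE// -!mulrA; congr (_ * _).
    rewrite /m /e1 /e2 -!expRD; congr expR; rewrite big_split/= sum_cst_seq -/N /b /q.
    by ring.
  apply; first by rewrite mulr_ge0 ?(ltW c10)// expR_ge0.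
  move=> t tI; have t0 : 0 < t by case/andP: tI => + _; apply: lt_le_trans.
  have [+ _] := H1 t t0; apply: le_trans; rewrite ler_wpM2l ?(ltW c10)//.
  by apply: heat_profile_ge; rewrite ?lexx ?(ltW D0) ?(ltW b0) ?(ltW hk).
apply: (@le_trans _ _ (\int[lebesgue_measure]_(t in [set` `]0%R, +oo[])
    ((c2 * M * e2)%:E * (expR (- (b * ln (D + t))))%:E)))%E.
  apply: ge0_le_integral_nomeas => t /=; rewrite in_itv/= andbT => t0.
    by rewrite lee_fin H0.
  rewrite -EFinM lee_fin; have [_ +] := H1 t t0; move/le_trans; apply.
  rewrite -(mulrA c2 M e2) -(mulrA c2) ler_wpM2l ?(ltW c20)//.
  exact: heat_profile_le b0 (ltW hk) q0 D0 t0.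
rewrite ge0_integralZl//=.
- rewrite (integral_shifted_power b1 D0) -EFinM lee_fin.
  rewrite le_eqVlt; apply/orP; left; apply/eqP; rewrite /e1 -/b; ring.
- apply/measurable_EFinP.
  apply: measurableT_comp => //; apply: measurable_funN; apply: measurable_funM => //.
  by apply: measurable_funTS; apply: measurableT_comp => //; exact: measurable_funD.
- by rewrite lee_fin !mulr_ge0 ?expR_ge0// ltW.
Qed.
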